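(* Let $(M^n,g)$ be a Riemannian spin manifold and $\mathrm{T}$ a $3$-form on $M^n$. For $s\in\mathbb{R}$ let $\nabla^s_X\psi=\nabla^g_X\psi+s\,(X\lrcorner\,\mathrm{T})\cdot\psi$ on spinor fields. Then the spinor Laplacian $\Delta^s$ of $\nabla^s$ and the square of the Dirac operator $D^{s/3}$ of $\nabla^{s/3}$ are related by $$(D^{s/3})^2=\Delta^s+s\, d\mathrm{T}+\frac14\,\mathrm{Scal}^g-2s^2\,\mathrm{T}_0^2 .$$
   Context: $\nabla^g$ is the Levi-Civita connection (lifted to the spinor bundle), $\mathrm{Scal}^g$ the Riemannian scalar curvature, $X\lrcorner\,\mathrm{T}$ the interior product; exterior forms act on spinors by Clifford multiplication, with convention $X\cdot X=-\|X\|^2$ and $e_{i_1}\wedge\dots\wedge e_{i_k}$ acting as $e_{i_1}\cdots e_{i_k}$ for an orthonormal frame. $\nabla^s$ on spinors is induced by the metric connection $\nabla^s_XY=\nabla^g_XY+2s\,\mathrm{T}(X,Y,-)$. For an orthonormal frame $e_1,\dots,e_n$: the Dirac operator is $D^s\psi=\sum_k e_k\cdot\nabla^s_{e_k}\psi$; the spinor Laplacian is $\Delta^s\psi=(\nabla^s)^*\nabla^s\psi=-\sum_k\big(\nabla^s_{e_k}\nabla^s_{e_k}\psi-\nabla^s_{\nabla^g_{e_k}e_k}\psi\big)$. $\mathrm{T}_0^2$ is the function $\mathrm{T}_0^2=\frac16\sum_{i,j=1}^n\|\mathrm{T}(e_i,e_j)\|^2$, where $\mathrm{T}(e_i,e_j)=\sum_k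 \mathrm{T}(e_i,e_j,e_k)e_k$ (the scalar part of the square of $\mathrm{T}$ in the Clifford algebra). *)

(* Defs.v *)
From mathcomp Require Import all_boot all_order all_algebra.
From mathcomp Require Import all_classical all_reals all_analysis.
From mathcomp Require Import complex.

Set Implicit Arguments.
Unset Strict Implicit.
Unset Printing Implicit Defensive.

Import Order.TTheory GRing.Theory Num.Theory.
Import numFieldNormedType.Exports.

Local Open Scope classical_set_scope.
Local Open Scope complex_scope.
Local Open Scope ring_scope.

(** Spinors.  A complex module of dimension 2^(n/2) over the Clifford algebra
    of R^n is automatically irreducible, and the restriction to Spin(n) of the
    corresponding representation is the (faithful) spin representation; Spin(n)
    is identified with its image. *)

Definition spin_dim (n : nat) : nat := (2 ^ n./2)%N.

Section Manifold.
Context {R : realType} {n : nat} {M : topologicalType}.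

(** Functions on M and on R^n are total; their values outside the open set
    under consideration are irrelevant. *)

Fixpoint Ck (k : nat) (U : set 'rV[R]_n) (f : 'rV[R]_n -> R) : Prop :=
  (forall x, U x -> {for x, continuous f}) /\
  if k is k'.+1 then
    forall i : 'I_n,
      (forall x, U x -> derivable f x (delta_mx 0 i)) /\
      Ck k' U ('D_(delta_mx 0 i) f)
  else True.

Definition Cinfty (U : set 'rV[R]_n) (f : 'rV[R]_n -> R) : Prop :=
  forall k, Ck k U f.

Record chart := Chart {
  chart_dom : set M;
  chart_map : M -> 'rV[R]_n;
  chart_inv : 'rV[R]_n -> M }.

Definition chart_img (c : chart) (W : set M) : set 'rV[R]_n :=
  chart_map c @` (W `&` chart_dom c).

Record is_chart (c : chart) : Prop := IsChart {
  chart_dom_open : open (chart_dom c);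
  chart_img_open : open (chart_img c setT);
  chart_mapK : forall p, chart_dom c p -> chart_inv c (chart_map c p) = p;
  chart_map_cont : forall p, chart_dom c p -> {for p, continuous (chart_map c)};
  chart_inv_cont : forall x, chart_img c setT x ->
    {for x, continuous (chart_inv c)} }.

Record smooth_manifold (A : set chart) : Prop := SmoothManifold {
  manifold_hausdorff : hausdorff_space M;
  manifold_second_countable : @second_countable M;
  atlas_chart : forall c, A c -> is_chart c;
  atlas_cover : forall p, exists2 c, A c & chart_dom c p;
  atlas_compatible : forall c d, A c -> A d -> forall i : 'I_n,
    Cinfty (chart_img c (chart_dom d))
           (fun x => chart_map d (chart_inv c x) 0 i) }.

Variable A : set chart.

Definition smooth_on (W : set M) (f : M -> R) : Prop :=
  forall c, A c -> Cinfty (chart_img c W) (fun x => f (chart_inv c x)).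

Definition smooth_near (p : M) (f : M -> R) : Prop :=
  exists W : set M, [/\ open W, W p & smooth_on W f].

(** T_p M is the space of derivations at p of germs of smooth functions.  The
    condition [tangent_junk] only normalizes the values at functions which are
    not smooth near p, so that equal derivations are equal as functions. *)
Definition tvec : Type := (M -> R) -> R.

Record tangent (p : M) (v : tvec) : Prop := Tangent {
  tangent_linear : forall (a : R) f h, smooth_near p f -> smooth_near p h ->
    v (fun q => a * f q + h q) = a * v f + v h;
  tangent_leibniz : forall f h, smooth_near p f -> smooth_near p h ->
    v (fun q => f q * h q) = v f * h p + f p * v h;
  tangent_germ : forall f h, (\forall q \near p, f q = h q) -> v f = v h;
  tangent_junk : forall f, ~ smooth_near p f -> v f = 0 }.

Definition tzero : tvec := fun _ => 0.
Definition tadd (v w : tvec) : tvec := fun f => v f + w f.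
Definition tscale (a : R) (v : tvec) : tvec := fun f => a * v f.
Definition tsub (v w : tvec) : tvec := tadd v (tscale (-1) w).

Definition vfield : Type := M -> tvec.

Definition smooth_vfield (W : set M) (X : vfield) : Prop :=
  (forall p, W p -> tangent p (X p)) /\
  (forall W' f, open W' -> W' `<=` W -> smooth_on W' f ->
     smooth_on W' (fun q => X q f)).

Definition smooth_vfield_near (p : M) (X : vfield) : Prop :=
  exists W : set M, [/\ open W, W p & smooth_vfield W X].

Definition lie_bracket (X Y : vfield) : vfield := fun p f =>
  if `[< smooth_near p f >]
  then X p (fun q => Y q f) - Y p (fun q => X q f) else 0.

Record riemannian_metric (g : M -> tvec -> tvec -> R) : Prop :=
  RiemannianMetric {
  metric_sym : forall p v w, tangent p v -> tangent p w -> g p v w = g p w v;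
  metric_linear : forall p a u v w,
    tangent p u -> tangent p v -> tangent p w ->
    g p (tadd (tscale a u) v) w = a * g p u w + g p v w;
  metric_pos : forall p v, tangent p v -> v <> tzero -> 0 < g p v v;
  metric_smooth : forall W X Y, open W ->
    smooth_vfield W X -> smooth_vfield W Y ->
    smooth_on W (fun p => g p (X p) (Y p)) }.

Record three_form (T : M -> tvec -> tvec -> tvec -> R) : Prop := ThreeForm {
  form_linear : forall p a u u' v w,
    tangent p u -> tangent p u' -> tangent p v -> tangent p w ->
    T p (tadd (tscale a u) u') v w = a * T p u v w + T p u' v w;
  form_antisym12 : forall p u v w,
    tangent p u -> tangent p v -> tangent p w -> T p u v w = - T p v u w;
  form_antisym23 : forall p u v w,
    tangent p u -> tangent p v -> tangent p w -> T p u v w = - T p u w v;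
  form_smooth : forall W X Y Z, open W ->
    smooth_vfield W X -> smooth_vfield W Y -> smooth_vfield W Z ->
    smooth_on W (fun p => T p (X p) (Y p) (Z p)) }.

(** Exterior derivative, normalized so that no factor 1/(k+1) appears, i.e.
    dT = sum_k e_k /\ nabla_{e_k} T for a torsion free nabla. *)
Definition ext_deriv (T : M -> tvec -> tvec -> tvec -> R)
    (X Y Z V : vfield) (p : M) : R :=
  X p (fun q => T q (Y q) (Z q) (V q)) - Y p (fun q => T q (X q) (Z q) (V q))
  + Z p (fun q => T q (X q) (Y q) (V q)) - V p (fun q => T q (X q) (Y q) (Z q))
  - T p (lie_bracket X Y p) (Z p) (V p) + T p (lie_bracket X Z p) (Y p) (V p)
  - T p (lie_bracket X V p) (Y p) (Z p) - T p (lie_bracket Y Z p) (X p) (V p)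
  + T p (lie_bracket Y V p) (X p) (Z p) - T p (lie_bracket Z V p) (X p) (Y p).

(** [nabla p v Y] is the covariant derivative of the local field Y in the
    direction v at the point p. *)
Record levi_civita (g : M -> tvec -> tvec -> R)
    (nabla : M -> tvec -> vfield -> tvec) : Prop := LeviCivita {
  lc_smooth : forall W X Y, open W ->
    smooth_vfield W X -> smooth_vfield W Y ->
    smooth_vfield W (fun p => nabla p (X p) Y);
  lc_linear : forall p a v w Y,
    tangent p v -> tangent p w -> smooth_vfield_near p Y ->
    nabla p (tadd (tscale a v) w) Y
    = tadd (tscale a (nabla p v Y)) (nabla p w Y);
  lc_germ : forall p v Y Z, tangent p v ->
    smooth_vfield_near p Y -> smooth_vfield_near p Z ->
    (\forall q \near p, Y q = Z q) -> nabla p v Y = nabla p v Z;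
  lc_add : forall p v Y Z, tangent p v ->
    smooth_vfield_near p Y -> smooth_vfield_near p Z ->
    nabla p v (fun q => tadd (Y q) (Z q)) = tadd (nabla p v Y) (nabla p v Z);
  lc_leibniz : forall p v f Y, tangent p v ->
    smooth_near p f -> smooth_vfield_near p Y ->
    nabla p v (fun q => tscale (f q) (Y q))
    = tadd (tscale (v f) (Y p)) (tscale (f p) (nabla p v Y));
  lc_metric : forall p v Y Z, tangent p v ->
    smooth_vfield_near p Y -> smooth_vfield_near p Z ->
    v (fun q => g q (Y q) (Z q)) = g p (nabla p v Y) (Z p) + g p (Y p) (nabla p v Z);
  lc_torsion_free : forall p Y Z,
    smooth_vfield_near p Y -> smooth_vfield_near p Z ->
    tsub (nabla p (Y p) Z) (nabla p (Z p) Y) = lie_bracket Y Z p }.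

Definition curvature (nabla : M -> tvec -> vfield -> tvec)
    (X Y Z : vfield) : vfield := fun p =>
  tsub (tsub (nabla p (X p) (fun q => nabla q (Y q) Z))
             (nabla p (Y p) (fun q => nabla q (X q) Z)))
       (nabla p (lie_bracket X Y p) Z).

Record orthonormal_frame (g : M -> tvec -> tvec -> R) (U : set M)
    (e : 'I_n -> vfield) : Prop := OrthonormalFrame {
  frame_open : open U;
  frame_smooth : forall i, smooth_vfield U (e i);
  frame_orthonormal : forall p i j, U p -> g p (e i p) (e j p) = (i == j)%:R;
  frame_span : forall p v, U p -> tangent p v ->
    exists c : 'I_n -> R, v = (fun f => \sum_i c i * e i p f) }.

Definition scalar_curvature (g : M -> tvec -> tvec -> R)
    (nabla : M -> tvec -> vfield -> tvec) (e : 'I_n -> vfield) (p : M) : R :=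
  \sum_i \sum_j g p (curvature nabla (e i) (e j) (e j) p) (e i p).

Definition T0_squared (g : M -> tvec -> tvec -> R)
    (T : M -> tvec -> tvec -> tvec -> R) (e : 'I_n -> vfield) (p : M) : R :=
  let Tvec i j : tvec :=
    fun f => \sum_k T p (e i p) (e j p) (e k p) * e k p f in
  6^-1 * \sum_i \sum_j g p (Tvec i j) (Tvec i j).

Definition clifford_rep (gam : 'I_n -> 'M[R[i]]_(spin_dim n)) : Prop :=
  forall i j, gam i *m gam j + gam j *m gam i = (- (2 * (i == j)%:R))%:M.

Variable gam : 'I_n -> 'M[R[i]]_(spin_dim n).

Definition cliff_vec (x : 'rV[R]_n) : 'M[R[i]]_(spin_dim n) :=
  \sum_i (x 0 i)%:C *: gam i.

Definition cliff2 (w : 'I_n -> 'I_n -> R) : 'M[R[i]]_(spin_dim n) :=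
  \sum_(i < n) \sum_(j < n | (i < j)%N) (w i j)%:C *: (gam i *m gam j).

Definition cliff4 (w : 'I_n -> 'I_n -> 'I_n -> 'I_n -> R) :
    'M[R[i]]_(spin_dim n) :=
  \sum_(i < n) \sum_(j < n | (i < j)%N) \sum_(k < n | (j < k)%N)
    \sum_(l < n | (k < l)%N)
      (w i j k l)%:C *: (gam i *m gam j *m gam k *m gam l).

Definition spin_group (h : 'M[R[i]]_(spin_dim n)) : Prop :=
  exists s : seq 'rV[R]_n,
    [/\ ~~ odd (size s),
        forall x, x \in s -> \sum_i x 0 i ^+ 2 = 1
      & h = \big[mulmx/1%:M]_(x <- s) cliff_vec x].

Definition smooth_onC (W : set M) (f : M -> R[i]) : Prop :=
  smooth_on W (fun q => complex.Re (f q)) /\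
  smooth_on W (fun q => complex.Im (f q)).

(** A spin structure in terms of local data: over an open cover U_a with local
    orthonormal frames e_a, a Spin(n)-valued cocycle h_ab lifting the transition
    functions of the frame bundle (coordinates with respect to e_b are turned
    into coordinates with respect to e_a). *)
Record spin_structure (g : M -> tvec -> tvec -> R) (I : Type)
    (U : I -> set M) (e : I -> 'I_n -> vfield)
    (h : I -> I -> M -> 'M[R[i]]_(spin_dim n)) : Prop := SpinStructure {
  spin_cover : forall p, exists a, U a p;
  spin_frame : forall a, orthonormal_frame g (U a) (e a);
  spin_valued : forall a b p, U a p -> U b p -> spin_group (h a b p);
  spin_smooth : forall a b k l,
    smooth_onC (U a `&` U b) (fun p => h a b p k l);
  spin_lift : forall a b p k, U a p -> U b p ->
    h a b p *m gam k
    = cliff_vec (\row_j g p (e a j p) (e b k p)) *m h a b p;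
  spin_cocycle : forall a b c p, U a p -> U b p -> U c p ->
    h a b p *m h b c p = h a c p }.

(** Spinor fields are sections of the associated bundle: [psi a] is the local
    expression over U_a. *)
Record spinor_field (I : Type) (U : I -> set M)
    (h : I -> I -> M -> 'M[R[i]]_(spin_dim n))
    (psi : I -> M -> 'cV[R[i]]_(spin_dim n)) : Prop := SpinorField {
  spinor_smooth : forall a k, smooth_onC (U a) (fun p => psi a p k 0);
  spinor_glue : forall a b p, U a p -> U b p ->
    psi a p = h a b p *m psi b p }.

Definition dspinor (v : tvec) (phi : M -> 'cV[R[i]]_(spin_dim n)) :
    'cV[R[i]]_(spin_dim n) :=
  \col_k (v (fun q => complex.Re (phi q k 0)) +i*
          v (fun q => complex.Im (phi q k 0))).

Section Operators.
Variables (g : M -> tvec -> tvec -> R) (nabla : M -> tvec -> vfield -> tvec).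
Variables (T : M -> tvec -> tvec -> tvec -> R).
Variables (I : Type) (e : I -> 'I_n -> vfield).
Implicit Types (s : R) (psi : I -> M -> 'cV[R[i]]_(spin_dim n)).

(** The lift of [nabla] to spinors: in the frame e it is
    d + 1/2 sum_(i<j) g(nabla e_i, e_j) e_i e_j. *)
Definition spin_nabla (X : vfield) psi : I -> M -> 'cV[R[i]]_(spin_dim n) :=
  fun a p => dspinor (X p) (psi a)
    + (2^-1)%:C *: (cliff2 (fun i j => g p (nabla p (X p) (e a i)) (e a j p))
                    *m psi a p).

Definition nabla_s s (X : vfield) psi : I -> M -> 'cV[R[i]]_(spin_dim n) :=
  fun a p => spin_nabla X psi a p
    + s%:C *: (cliff2 (fun i j => T p (X p) (e a i p) (e a j p)) *m psi a p).

Definition dirac_op s psi : I -> M -> 'cV[R[i]]_(spin_dim n) :=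
  fun a p => \sum_k gam k *m nabla_s s (e a k) psi a p.

Definition spinor_laplacian s psi : I -> M -> 'cV[R[i]]_(spin_dim n) :=
  fun a p => - \sum_k
    (nabla_s s (e a k) (nabla_s s (e a k) psi) a p
     - nabla_s s (fun q => nabla q (e a k q) (e a k)) psi a p).

Definition dT_action psi : I -> M -> 'cV[R[i]]_(spin_dim n) :=
  fun a p =>
    cliff4 (fun i j k l => ext_deriv T (e a i) (e a j) (e a k) (e a l) p)
    *m psi a p.

End Operators.

End Manifold.

Arguments chart R n M : clear implicits.
Arguments tvec R M : clear implicits.
Arguments vfield R M : clear implicits.

(* Main.v *)
Require Import Defs.
From mathcomp Require Import all_boot all_order all_algebra.
From mathcomp Require Import all_classical all_reals all_analysis.
From mathcomp Require Import complex ring zify.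

Set Implicit Arguments.
Unset Strict Implicit.
Unset Printing Implicit Defensive.

Import Order.TTheory GRing.Theory Num.Theory.
Import numFieldNormedType.Exports.

Local Open Scope classical_set_scope.
Local Open Scope complex_scope.
Local Open Scope ring_scope.

(** Everything takes place in one orthonormal frame e_1, ..., e_n of the spin
    structure, in which spinor fields are functions with values in C^N.  There
    nabla^s_(e_k) = nabla_k + s tau_k, where nabla_k = d_(e_k) + B_k is the
    Levi-Civita derivative of spinors and tau_k is the Clifford action of the
    2-form T(e_k, -, -).  As sum_k e_k tau_k = 3 T, the operator D^(s/3) is
    D + s T with D the Riemannian Dirac operator.  Hence, with Delta the
    Laplacian of nabla,

      D^(s/3) D^(s/3) = D D + s (D T + T D) + s^2 T T,
      Delta^s = Delta - s sum_k ((nabla_k T)(e_k, -, -) + 2 tau_k nabla_k)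
                - s^2 sum_k tau_k tau_k,

    and the powers of s can be compared one at a time.

    - Order 0 is the Lichnerowicz formula D D = Delta + Scal / 4
      ([lichnerowicz_at]).  The antisymmetric part of sum e_k e_l nabla_k nabla_l
      is the curvature, and the first Bianchi identity collapses its Clifford
      contraction to the scalar curvature ([sum_gam_curvature]).
    - Order 1 rests on e_k T + T e_k = - 2 tau_k ([cl_three_gam]), which matches
      the first order terms, and on
      sum_k e_k (nabla_k T) = dT - sum_k (nabla_k T)(e_k, -, -)
      ([sum_gam_cl_three]), which leaves exactly dT.
    - Order 2 is the identity T T = - sum_k tau_k tau_k - 2 T_0^2
      ([cl_three_sqr]).

    [dirac_square_at] combines the three into one identity at a point.  Its
    geometric input is that B_k acts on the Clifford algebra as the derivation
    which extends the rotation of vectors by the connection coefficients, so that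
    nabla_k obeys a Leibniz rule for products of forms and spinors
    ([spin_cov_gam], [spin_cov_torsion_two], [spin_cov_torsion_three]); that the
    commutator of the nabla_k is the spin lift of the Riemann tensor
    ([spin_curvature]); that this tensor satisfies the Bianchi identity, a
    consequence of the Jacobi identity for vector fields ([riem_bianchi]); and
    that dT is the alternation of nabla T because nabla is torsion free
    ([ext_deriv_frame]).  No special frame is chosen at the point: connection
    coefficients are carried along and cancel by their antisymmetry, which is the
    compatibility of nabla with the metric. *)

(** * Sums over increasing indices *)

Section SortedSums.
Variables (V : zmodType) (n : nat).

Let sumD2 (f g : 'I_n -> 'I_n -> V) :
  \sum_i \sum_j (f i j + g i j) = \sum_i \sum_j f i j + \sum_i \sum_j g i j.
Proof. by rewrite -big_split; apply: eq_bigr => i _; rewrite -big_split. Qed.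

Let sumD3 (f g : 'I_n -> 'I_n -> 'I_n -> V) :
  \sum_i \sum_j \sum_k (f i j k + g i j k)
  = \sum_i \sum_j \sum_k f i j k + \sum_i \sum_j \sum_k g i j k.
Proof. by rewrite -big_split; apply: eq_bigr => i _; rewrite sumD2. Qed.

Let sumD4 (f g : 'I_n -> 'I_n -> 'I_n -> 'I_n -> V) :
  \sum_i \sum_j \sum_k \sum_l (f i j k l + g i j k l)
  = \sum_i \sum_j \sum_k \sum_l f i j k l
  + \sum_i \sum_j \sum_k \sum_l g i j k l.
Proof. by rewrite -big_split; apply: eq_bigr => i _; rewrite sumD3. Qed.

(** For symmetric summands vanishing on the diagonal, sums over increasing
    indices are fractions of the full sums.  The cases of three and four indices
    follow by inserting the last index, in all possible positions, into an
    increasing sequence of the others. *)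
Lemma sum_ltn2 (f : 'I_n -> 'I_n -> V) :
  (forall i j, f i j = f j i) -> (forall i, f i i = 0) ->
  \sum_i \sum_j f i j = (\sum_(i < n) \sum_(j < n | (i < j)%N) f i j) *+ 2.
Proof.
move=> fC f0.
have -> : \sum_(i < n) \sum_(j < n | (i < j)%N) f i j
    = \sum_(i < n) \sum_(j < n) f i j *+ (i < j)%N.
  apply: eq_bigr => i _; rewrite big_mkcond.
  by apply: eq_bigr => j _; rewrite mulrb.
transitivity (\sum_(i < n) \sum_(j < n) (f i j *+ (i < j)%N + f i j *+ (j < i)%N)).
  apply: eq_bigr => i _; apply: eq_bigr => j _.
  have [->|ij] := eqVneq i j; first by rewrite f0 !mul0rn addr0.
  have ij' : i != j :> nat by [].
  by rewrite -mulrnDr (_ : (_ + _ = 1)%N) //; lia.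
rewrite sumD2 mulr2n; congr (_ + _).
by rewrite exchange_big; apply: eq_bigr => i _; apply: eq_bigr => j _; rewrite fC.
Qed.

Lemma sum_ltn3 (f : 'I_n -> 'I_n -> 'I_n -> V) :
  (forall i j k, f i j k = f j i k) -> (forall i j k, f i j k = f i k j) ->
  (forall i k, f i i k = 0) ->
  \sum_i \sum_j \sum_k f i j k
  = (\sum_(i < n) \sum_(j < n | (i < j)%N) \sum_(k < n | (j < k)%N) f i j k) *+ 6.
Proof.
move=> fC12 fC23 f0.
have -> : \sum_i \sum_j \sum_k f i j k =
    (\sum_(i < n) \sum_(j < n | (i < j)%N) \sum_k f i j k) *+ 2.
  apply: sum_ltn2 => [i j|i]; first by apply: eq_bigr => k _; rewrite fC12.
  by rewrite big1.
rewrite (mulrnA _ 3 2); congr (_ *+ 2).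
transitivity (\sum_(i < n) \sum_(j < n) \sum_(k < n) (f i j k *+ (k < i < j)%N
   + f i j k *+ (i < k < j)%N + f i j k *+ (i < j < k)%N)).
  apply: eq_bigr => i _; rewrite big_mkcond; apply: eq_bigr => j _.
  transitivity (\sum_(k < n) f i j k *+ (i < j)%N).
    by case: ifP => _ //; rewrite big1.
  apply: eq_bigr => k _.
  have [->|ik] := eqVneq i k; first by rewrite fC23 f0 !mul0rn !addr0.
  have [->|jk] := eqVneq j k; first by rewrite fC12 fC23 f0 !mul0rn !addr0.
  have ik' : i != k :> nat by []. have jk' : j != k :> nat by [].
  by rewrite -!mulrnDr; congr (_ *+ _); lia.
set S := RHS.
have E : S = (\sum_(i < n) \sum_(j < n) \sum_(k < n) f i j k *+ (i < j < k)%N) *+ 3.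
  congr (_ *+ 3); apply: eq_bigr => i _; rewrite big_mkcond; apply: eq_bigr => j _.
  rewrite big_mkcond; case: ifP => ij.
    by apply: eq_bigr => k _; rewrite mulrb.
  by rewrite big1.
rewrite E mulrS mulr2n addrA.
rewrite !sumD3; congr (_ + _ + _).
  under eq_bigr do rewrite exchange_big; rewrite exchange_big /=.
  apply: eq_bigr => i _; apply: eq_bigr => j _; apply: eq_bigr => k _.
  by rewrite fC23 fC12.
apply: eq_bigr => i _; rewrite exchange_big.
by apply: eq_bigr => j _; apply: eq_bigr => k _; rewrite fC23.
Qed.

Lemma sum_ltn4 (f : 'I_n -> 'I_n -> 'I_n -> 'I_n -> V) :
  (forall i j k l, f i j k l = f j i k l) ->
  (forall i j k l, f i j k l = f i k j l) ->
  (forall i j k l, f i j k l = f i j l k) ->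
  (forall i k l, f i i k l = 0) ->
  \sum_i \sum_j \sum_k \sum_l f i j k l
  = (\sum_(i < n) \sum_(j < n | (i < j)%N) \sum_(k < n | (j < k)%N) \sum_(l < n | (k < l)%N)
       f i j k l) *+ 24.
Proof.
move=> fC12 fC23 fC34 f0.
have -> : \sum_i \sum_j \sum_k \sum_l f i j k l =
    (\sum_(i < n) \sum_(j < n | (i < j)%N) \sum_(k < n | (j < k)%N) \sum_l f i j k l) *+ 6.
  apply: sum_ltn3 => [i j k|i j k|i k]; last by rewrite big1.
    by apply: eq_bigr => l _; rewrite fC12.
  by apply: eq_bigr => l _; rewrite fC23.
rewrite (mulrnA _ 4 6); congr (_ *+ 6).
transitivity (\sum_(i < n) \sum_(j < n) \sum_(k < n) \sum_(l < n) (
     f i j k l *+ [&& l < i, i < j & j < k]%N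
   + f i j k l *+ [&& i < l, l < j & j < k]%N + f i j k l *+ [&& i < j, j < l & l < k]%N
   + f i j k l *+ [&& i < j, j < k & k < l]%N)).
  apply: eq_bigr => i _; rewrite big_mkcond; apply: eq_bigr => j _.
  transitivity (\sum_(k < n) \sum_(l < n) f i j k l *+ (i < j < k)%N).
    case: ifP => ij; last by rewrite big1 // => k _; rewrite big1.
    rewrite big_mkcond; apply: eq_bigr => k _.
    by rewrite /=; case: ifP => _; [|rewrite big1].
  apply: eq_bigr => k _; apply: eq_bigr => l _.
  have [->|il] := eqVneq i l; first by rewrite fC34 fC23 f0 !mul0rn !addr0.
  have [->|jl] := eqVneq j l; first by rewrite fC34 fC12 fC23 f0 !mul0rn !addr0.
  have [->|kl] := eqVneq k l.
    by rewrite fC23 fC12 fC34 fC23 f0 !mul0rn !addr0.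
  have il' : i != l :> nat by []. have jl' : j != l :> nat by [].
  have kl' : k != l :> nat by [].
  by rewrite -!mulrnDr; congr (_ *+ _); lia.
set S := RHS.
have E : S = (\sum_(i < n) \sum_(j < n) \sum_(k < n) \sum_(l < n)
    f i j k l *+ [&& i < j, j < k & k < l]%N) *+ 4.
  congr (_ *+ 4); apply: eq_bigr => i _; rewrite big_mkcond; apply: eq_bigr => j _.
  rewrite big_mkcond; case: ifP => ij; last by rewrite big1 // => k _; rewrite big1.
  apply: eq_bigr => k _; rewrite big_mkcond.
  by case: ifP => jk; [apply: eq_bigr => l _; rewrite mulrb | rewrite big1].
rewrite E !mulrS mulr0n addr0 !addrA.
rewrite !sumD4; congr (_ + _ + _ + _).
- under eq_bigr do (under eq_bigr do rewrite exchange_big; rewrite exchange_big).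
  rewrite exchange_big /=.
  apply: eq_bigr => i _; apply: eq_bigr => j _; apply: eq_bigr => k _.
  by apply: eq_bigr => l _; rewrite fC34 fC23 fC12.
- apply: eq_bigr => i _; under eq_bigr do rewrite exchange_big.
  rewrite exchange_big /=; apply: eq_bigr => j _; apply: eq_bigr => k _.
  by apply: eq_bigr => l _; rewrite fC34 fC23.
- apply: eq_bigr => i _; apply: eq_bigr => j _; rewrite exchange_big.
  by apply: eq_bigr => k _; apply: eq_bigr => l _; rewrite fC34.
Qed.

End SortedSums.

(** * Clifford algebra *)

Section MatrixEntries.
Variables (K : pzRingType) (m n : nat).
Implicit Types (x y : 'M[K]_(m, n)).
Lemma mxD x y i j : (x + y) i j = x i j + y i j. Proof. by rewrite mxE. Qed.
Lemma mxN x i j : (- x) i j = - x i j. Proof. by rewrite mxE. Qed.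
Lemma mxZ c x i j : (c *: x) i j = c * x i j. Proof. by rewrite mxE. Qed.
Lemma mx0E i j : (0 : 'M[K]_(m, n)) i j = 0. Proof. by rewrite mxE. Qed.
End MatrixEntries.

(** Linear identities between matrices, checked entrywise with all products and
    sums of matrices as atoms. *)
Ltac mx_ring :=
  apply/matrixP => ? ?; rewrite ?(mxD, mxN, mxZ, mx0E); ring.
Ltac mx_field :=
  apply/matrixP => ? ?; rewrite ?(mxD, mxN, mxZ, mx0E); field.

Section SecondDerivatives.
Variables (K : fieldType) (N q : nat).
Implicit Types (c s z : 'M[K]_N) (d x : 'M[K]_(N, q)).

Lemma second_derivative_expand d x dk dl cl sk sl :
  d + (cl *m x + sl *m dk) + sk *m (dl + sl *m x)
  = d + cl *m x + sl *m dk + sk *m dl + sk *m sl *m x.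
Proof. by rewrite mulmxDr mulmxA !addrA. Qed.

(** The curvature of a connection d + s: the terms in the first derivatives
    dk and dl of x are symmetric and cancel.  The subtracted dkl - dlk + z x is the
    covariant derivative along the bracket of the two directions. *)
Lemma second_derivative_comm dkl dlk x dk dl ck cl sk sl z :
  dkl + cl *m x + sl *m dk + sk *m dl + sk *m sl *m x
  - (dlk + ck *m x + sk *m dl + sl *m dk + sl *m sk *m x)
  - (dkl - dlk + z *m x)
  = (cl - ck - z + (sk *m sl - sl *m sk)) *m x.
Proof. rewrite !mulmxDl !mulNmx; mx_ring. Qed.

Lemma connection_sum (J : finType) (a : J -> K) (d : J -> 'M[K]_(N, q))
    (c s : J -> 'M[K]_N) (b : K) x :
  \sum_j a j *: d j + (\sum_j a j *: c j) *m x + b *: ((\sum_j a j *: s j) *m x)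
  = \sum_j a j *: (d j + c j *m x + b *: (s j *m x)).
Proof.
rewrite !mulmx_suml scaler_sumr -!big_split; apply: eq_bigr => j _ /=.
rewrite -!scalemxAl; mx_ring.
Qed.

End SecondDerivatives.

Section Clifford.
Variables (K : numFieldType) (n N : nat) (gam : 'I_n -> 'M[K]_N).
Hypothesis gam_clifford : forall i j,
  gam i *m gam j + gam j *m gam i = (- (2 * (i == j)%:R))%:M.

Lemma gamC i j :
  gam i *m gam j = - (gam j *m gam i) - (2 * (i == j)%:R) *: 1%:M.
Proof.
by rewrite [LHS](canRL (addrK _) (gam_clifford i j)) addrC scalemx1 raddfN.
Qed.

Lemma sum_deltal q (F : 'I_n -> 'M[K]_(N, q)) i :
  \sum_j (i == j)%:R *: F j = F i.
Proof.
rewrite (bigD1 i) //= eqxx scale1r big1 ?addr0 // => j /negPf.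
by rewrite eq_sym => ->; rewrite scale0r.
Qed.

Lemma sum_deltar q (F : 'I_n -> 'M[K]_(N, q)) i :
  \sum_j (j == i)%:R *: F j = F i.
Proof. by rewrite -[RHS]sum_deltal; apply: eq_bigr => j _; rewrite eq_sym. Qed.

(** Locked, like the other Clifford actions below, since matching up to unfolding
    of these sums of matrices is prohibitively slow. *)
Definition cl_vec (x : 'I_n -> K) : 'M[K]_N :=
  locked (\sum_i x i *: gam i).

Lemma cl_vecE x : cl_vec x = \sum_i x i *: gam i.
Proof. by rewrite /cl_vec -lock. Qed.

Lemma eq_cl_vec x y : x =1 y -> cl_vec x = cl_vec y.
Proof. by move=> xy; rewrite !cl_vecE; apply: eq_bigr => i _; rewrite xy. Qed.

Lemma cl_vecN x : cl_vec (fun i => - x i) = - cl_vec x.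
Proof. by rewrite !cl_vecE -sumrN; apply: eq_bigr => i _; rewrite scaleNr. Qed.

Lemma cl_vecD x y : cl_vec (fun i => x i + y i) = cl_vec x + cl_vec y.
Proof. by rewrite !cl_vecE -big_split; apply: eq_bigr => i _; rewrite scalerDl. Qed.

Lemma cl_vecZ c x : cl_vec (fun i => c * x i) = c *: cl_vec x.
Proof. by rewrite !cl_vecE scaler_sumr; apply: eq_bigr => i _; rewrite scalerA. Qed.

Lemma cl_vec_sum (J : finType) (a : J -> K) (x : J -> 'I_n -> K) :
  \sum_l a l *: cl_vec (x l) = cl_vec (fun m => \sum_l a l * x l m).
Proof.
under eq_bigr do rewrite cl_vecE scaler_sumr.
rewrite exchange_big cl_vecE; apply: eq_bigr => m _ /=.
by rewrite scaler_suml; apply: eq_bigr => l _; rewrite scalerA.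
Qed.

Lemma cl_vecC x j :
  cl_vec x *m gam j = - (gam j *m cl_vec x) - (2 * x j) *: 1%:M.
Proof.
rewrite cl_vecE mulmx_suml mulmx_sumr -sumrN -scalerA -(sum_deltar (fun i => x i *: 1%:M)).
rewrite scaler_sumr -sumrB; apply: eq_bigr => i _.
rewrite -scalemxAl -scalemxAr gamC. mx_ring.
Qed.

Lemma cl_vec_sqr x : cl_vec x *m cl_vec x = - (\sum_i x i ^+ 2) *: 1%:M.
Proof.
suff: 2%:R *: (cl_vec x *m cl_vec x) = 2%:R *: (- (\sum_i x i ^+ 2) *: 1%:M).
  by apply: scalerI; rewrite pnatr_eq0.
have El : cl_vec x *m cl_vec x = \sum_i x i *: (gam i *m cl_vec x).
  by rewrite {1}cl_vecE mulmx_suml; apply: eq_bigr => i _; rewrite scalemxAl.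
have Er : cl_vec x *m cl_vec x = \sum_i x i *: (cl_vec x *m gam i).
  by rewrite {2}cl_vecE mulmx_sumr; apply: eq_bigr => i _; rewrite scalemxAr.
rewrite scaler_nat mulr2n {1}El Er -big_split /=.
rewrite scalerA mulrN -mulNr mulr_sumr scaler_suml; apply: eq_bigr => i _.
rewrite cl_vecC. mx_ring.
Qed.

Definition antisym (w : 'I_n -> 'I_n -> K) := forall i j, w i j = - w j i.

Lemma antisym_diag (w : 'I_n -> 'I_n -> K) i : antisym w -> w i i = 0.
Proof. by move=> wA; apply/eqP; rewrite -[_ == 0](mulrn_eq0 _ 2) mulr2n {1}wA addNr. Qed.

(** The action of the 2-form sum_(i < j) w_ij e_i /\ e_j.  The sum runs over all
    pairs of indices, which can be renamed freely, whence the factor. *)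
Definition cl_two (w : 'I_n -> 'I_n -> K) : 'M[K]_N :=
  locked (2^-1 *: \sum_i gam i *m cl_vec (w i)).

Lemma cl_twoE w : cl_two w = 2^-1 *: \sum_i gam i *m cl_vec (w i).
Proof. by rewrite /cl_two -lock. Qed.

Lemma eq_cl_two w v : (forall i j, w i j = v i j) -> cl_two w = cl_two v.
Proof.
by move=> wv; rewrite !cl_twoE; congr (_ *: _); apply: eq_bigr => i _; rewrite (eq_cl_vec (wv i)).
Qed.

Lemma cl_twoD w v : cl_two (fun i j => w i j + v i j) = cl_two w + cl_two v.
Proof.
rewrite !cl_twoE -scalerDr -big_split; congr (_ *: _); apply: eq_bigr => i _.
by rewrite cl_vecD mulmxDr.
Qed.

Lemma cl_twoZ c w : cl_two (fun i j => c * w i j) = c *: cl_two w.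
Proof.
rewrite !cl_twoE scalerA [c * _]mulrC -scalerA; congr (_ *: _); rewrite scaler_sumr; apply: eq_bigr => i _.
by rewrite cl_vecZ scalemxAr.
Qed.

Lemma cl_twoN w : cl_two (fun i j => - w i j) = - cl_two w.
Proof.
rewrite -scaleN1r -cl_twoZ; apply: eq_cl_two => i j; ring.
Qed.

Lemma cl_two_sum (J : finType) (a : J -> K) (w : J -> 'I_n -> 'I_n -> K) :
  \sum_l a l *: cl_two (w l) = cl_two (fun i j => \sum_l a l * w l i j).
Proof.
transitivity (2^-1 *: \sum_l a l *: \sum_i gam i *m cl_vec (w l i)).
  by rewrite scaler_sumr; apply: eq_bigr => l _; rewrite cl_twoE !scalerA mulrC.
under eq_bigr do rewrite scaler_sumr.
rewrite exchange_big cl_twoE; congr (_ *: _); apply: eq_bigr => i _ /=.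
rewrite -cl_vec_sum mulmx_sumr; apply: eq_bigr => l _.
by rewrite scalemxAr.
Qed.

Lemma sum_gam_cl_vec w : \sum_i gam i *m cl_vec (w i) = 2 *: cl_two w.
Proof. by rewrite cl_twoE scalerA divff ?scale1r // pnatr_eq0. Qed.

Lemma sum_gam_cl_vecT w : antisym w ->
  \sum_i gam i *m cl_vec (w^~ i) = - 2 *: cl_two w.
Proof.
move=> wA; rewrite scaleNr -sum_gam_cl_vec -sumrN; apply: eq_bigr => i _.
by rewrite -mulmxN -cl_vecN; congr (_ *m _); apply: eq_cl_vec => j.
Qed.

Lemma sum_cl_vec_gam w : antisym w ->
  \sum_i cl_vec (w i) *m gam i = - 2 *: cl_two w.
Proof.
move=> wA; under eq_bigr do rewrite cl_vecC.
rewrite sumrB sumrN sum_gam_cl_vec -scaler_suml -mulr_sumr.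
rewrite big1 ?mulr0 ?scale0r ?subr0 ?scaleNr// => i _.
exact: antisym_diag.
Qed.


(** Commuting with a 2-form rotates vectors: this is the isomorphism, up to the
    factor 2, between the Lie algebras spin(n) and so(n). *)
Lemma cl_two_gam w l : antisym w ->
  cl_two w *m gam l = gam l *m cl_two w + 2 *: cl_vec (w l).
Proof.
move=> wA.
suff E : \sum_i gam i *m cl_vec (w i) *m gam l =
    gam l *m (\sum_i gam i *m cl_vec (w i)) + 4 *: cl_vec (w l).
  rewrite !cl_twoE -scalemxAl mulmx_suml E -scalemxAr scalerDr scalerA.
  by congr (_ + _ *: _); field.
transitivity (\sum_i (gam l *m (gam i *m cl_vec (w i))
   + 2 *: ((i == l)%:R *: cl_vec (w i)) - 2 *: (w i l *: gam i))).
  apply: eq_bigr => i _; rewrite -mulmxA cl_vecC mulmxBr mulmxN !mulmxA.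
  rewrite [gam i *m gam l]gamC mulmxBl mulNmx -scalemxAl mul1mx -scalemxAr mulmx1.
  mx_ring.
rewrite sumrB big_split /= -!scaler_sumr sum_deltar -mulmx_sumr.
suff -> : \sum_i w i l *: gam i = - cl_vec (w l) by mx_ring.
by rewrite -cl_vecN cl_vecE; apply: eq_bigr => i _; rewrite -wA.
Qed.

Lemma cl_two_vec w x : antisym w ->
  cl_two w *m cl_vec x
  = cl_vec x *m cl_two w + 2 *: cl_vec (fun m => \sum_l x l * w l m).
Proof.
move=> wA; rewrite -cl_vec_sum [cl_vec x]cl_vecE mulmx_sumr mulmx_suml scaler_sumr -big_split.
apply: eq_bigr => l _; rewrite -scalemxAr cl_two_gam // -scalemxAl; mx_ring.
Qed.

(** The commutator with a 2-form is a derivation, so it rotates each index. *)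
Lemma cl_two_comm w v : antisym w ->
  cl_two w *m cl_two v - cl_two v *m cl_two w =
  2 *: cl_two (fun i j => \sum_m (w m i * v m j + v i m * w m j)).
Proof.
move=> wA.
set u := fun i j => _.
suff E : cl_two w *m (\sum_i gam i *m cl_vec (v i)) =
         (\sum_i gam i *m cl_vec (v i)) *m cl_two w +
          2 *: \sum_i gam i *m cl_vec (u i).
  rewrite [cl_two v]cl_twoE -scalemxAr E -scalemxAl (sum_gam_cl_vec u).
  by mx_field.
transitivity (\sum_i (gam i *m cl_vec (v i) *m cl_two w
   + 2 *: (cl_vec (w i) *m cl_vec (v i))
   + 2 *: (gam i *m cl_vec (fun m => \sum_l v i l * w l m)))).
  rewrite mulmx_sumr; apply: eq_bigr => i _; rewrite mulmxA cl_two_gam //.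
  rewrite mulmxDl -mulmxA cl_two_vec // mulmxDr mulmxA -!scalemxAr -!scalemxAl.
  mx_ring.
rewrite !big_split /= -mulmx_suml -!scaler_sumr -addrA -scalerDr.
congr (_ + _ *: _).
transitivity (\sum_i gam i *m cl_vec (fun m => \sum_l w l i * v l m) +
    \sum_i gam i *m cl_vec (fun m => \sum_l v i l * w l m)).
  congr (_ + _); under eq_bigr do rewrite {1}cl_vecE mulmx_suml.
  rewrite exchange_big; apply: eq_bigr => i _ /=.
  rewrite -cl_vec_sum mulmx_sumr; apply: eq_bigr => l _.
  by rewrite -scalemxAl -scalemxAr.
rewrite -big_split; apply: eq_bigr => i _ /=; rewrite -mulmxDr -cl_vecD.
by congr (_ *m _); apply: eq_cl_vec => j; rewrite -big_split.
Qed.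

Definition alternating3 (t : 'I_n -> 'I_n -> 'I_n -> K) :=
  (forall i j k, t i j k = - t j i k) /\ (forall i, antisym (t i)).

(** A cyclic permutation of three indices is even. *)
Lemma alternating3_rot t i j k : alternating3 t -> t i j k = t k i j.
Proof. by case=> t12 t23; rewrite t23 t12 opprK. Qed.

(** The action of a 3-form, written through its contractions t_i with the e_i:
    sum_i e_i /\ t_i counts every term three times. *)
Definition cl_three (t : 'I_n -> 'I_n -> 'I_n -> K) : 'M[K]_N :=
  locked (3^-1 *: \sum_i gam i *m cl_two (t i)).

Lemma cl_threeE t : cl_three t = 3^-1 *: \sum_i gam i *m cl_two (t i).
Proof. by rewrite /cl_three -lock. Qed.

Lemma sum_gam_cl_two t : \sum_i gam i *m cl_two (t i) = 3 *: cl_three t.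
Proof. by rewrite cl_threeE scalerA divff ?scale1r // pnatr_eq0. Qed.

(** For a 3-form, e_k t = e_k /\ t - e_k _| t and t e_k = - e_k /\ t - e_k _| t, so
    only the contraction survives in the anticommutator.  Here it is found by
    moving e_k through sum_i e_i t_i. *)
Lemma cl_three_gam t k : alternating3 t ->
  cl_three t *m gam k = - (gam k *m cl_three t) - 2 *: cl_two (t k).
Proof.
move=> [t12 t23].
suff E : (\sum_i gam i *m cl_two (t i)) *m gam k =
   - (gam k *m (\sum_i gam i *m cl_two (t i))) - 6 *: cl_two (t k).
  by rewrite !cl_threeE -scalemxAl E -(scalemxAr 3^-1); mx_field.
transitivity (\sum_i (- (gam k *m (gam i *m cl_two (t i)))
   - 2 *: ((i == k)%:R *: cl_two (t i)) + 2 *: (gam i *m cl_vec (t i k)))).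
  rewrite mulmx_suml; apply: eq_bigr => i _.
  rewrite -mulmxA cl_two_gam // mulmxDr !mulmxA gamC mulmxBl mulNmx.
  rewrite -scalemxAl -scalemxAr mul1mx; mx_ring.
rewrite big_split sumrB sumrN /= -!scaler_sumr sum_deltar -mulmx_sumr.
suff -> : \sum_i gam i *m cl_vec (t i k) = - 2 *: cl_two (t k) by mx_ring.
rewrite -sum_gam_cl_vecT //; apply: eq_bigr => i _; congr (_ *m _).
by apply: eq_cl_vec => j; rewrite t12 t23 opprK; rewrite t12 t23 opprK.
Qed.

Lemma cl_two_three_comm w t : antisym w ->
  cl_two w *m cl_three t - cl_three t *m cl_two w =
  2 *: cl_three (fun i j k =>
         \sum_m (w m i * t m j k + w m j * t i m k + w m k * t i j m)).
Proof.
move=> wA; set t' := fun i j k => _.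
suff E : cl_two w *m (\sum_i gam i *m cl_two (t i)) =
    (\sum_i gam i *m cl_two (t i)) *m cl_two w +
    2 *: \sum_i gam i *m cl_two (t' i).
  rewrite [cl_three t]cl_threeE -scalemxAr E -scalemxAl (sum_gam_cl_two t').
  by mx_field.
transitivity (\sum_i (gam i *m cl_two (t i) *m cl_two w
  + 2 *: (cl_vec (w i) *m cl_two (t i))
  + 2 *: (gam i *m cl_two (fun j k => \sum_m (w m j * t i m k + t i j m * w m k))))).
  rewrite mulmx_sumr; apply: eq_bigr => i _; rewrite mulmxA cl_two_gam //.
  rewrite mulmxDl -mulmxA [cl_two w *m _](canRL (subrK _) (cl_two_comm _ wA)).
  rewrite mulmxDr mulmxA -!scalemxAr -!scalemxAl; mx_ring.
rewrite !big_split /= -mulmx_suml -!scaler_sumr -addrA -scalerDr.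
congr (_ + _ *: _).
transitivity (\sum_i gam i *m cl_two (fun j k => \sum_m w m i * t m j k) +
  \sum_i gam i *m cl_two (fun j k => \sum_m (w m j * t i m k + t i j m * w m k))).
  congr (_ + _); under eq_bigr do rewrite {1}cl_vecE mulmx_suml.
  rewrite exchange_big; apply: eq_bigr => i _ /=.
  rewrite -cl_two_sum mulmx_sumr; apply: eq_bigr => l _.
  by rewrite -scalemxAl -scalemxAr.
rewrite -big_split; apply: eq_bigr => i _ /=; rewrite -mulmxDr -cl_twoD.
congr (_ *m _); apply: eq_cl_two => j k; rewrite -big_split; apply: eq_bigr => m _ /=.
by rewrite addrA [t i j m * _]mulrC.
Qed.

Section ThreeFormSquare.
Variable t : 'I_n -> 'I_n -> 'I_n -> K.
Hypothesis tA : alternating3 t.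
Local Notation tau k := (cl_two (t k)).
Local Notation tv k l := (cl_vec (t k l)).

Let tvC k l : tv k l = - tv l k.
Proof. by rewrite -cl_vecN; apply: eq_cl_vec => m; rewrite tA.1. Qed.

Let sum_tv_gam i : \sum_k tv k i *m gam k = 2 *: tau i.
Proof.
have := sum_cl_vec_gam (tA.2 i).
under eq_bigr do rewrite tvC mulNmx.
by rewrite sumrN => /(canRL (@opprK _)) ->; rewrite scaleNr opprK.
Qed.

Let sum_gam_tv i : \sum_k gam k *m tv k i = - 2 *: tau i.
Proof.
by under eq_bigr do rewrite tvC mulmxN; rewrite sumrN sum_gam_cl_vec scaleNr.
Qed.

(** The commutator of a contraction with the form itself, from
    6 t = sum_(l,i) e_l e_i t_li, the commutator with the 2-form t_k being a
    derivation.  It is left in terms of products of contractions, as the sum over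
    k in the next proof brings all of them back to squares. *)
Let cl_two_three_expand k :
  tau k *m (6 *: cl_three t) = (6 *: cl_three t) *m tau k
  + 8 *: (\sum_i tv k i *m tau i) + 4 *: (\sum_i tau i *m tv k i)
  - 4 *: (\sum_i \sum_l t k i l *: tv l i).
Proof.
have -> : 6 *: cl_three t = \sum_l gam l *m \sum_i gam i *m tv l i.
  under eq_bigr do rewrite sum_gam_cl_vec -scalemxAr.
  by rewrite -scaler_sumr sum_gam_cl_two; mx_ring.
have E1 l : tau k *m (gam l *m \sum_i gam i *m tv l i) =
     gam l *m (\sum_i gam i *m tv l i) *m tau k
   + 2 *: (\sum_i gam l *m (gam i *m cl_vec (fun m => \sum_r t l i r * t k r m)))
   + 2 *: (\sum_i gam l *m tv k i *m tv l i) + 4 *: (tv k l *m tau l).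
  transitivity (\sum_i (gam l *m (gam i *m tv l i) *m tau k
    + 2 *: (gam l *m (gam i *m cl_vec (fun m => \sum_r t l i r * t k r m)))
    + 2 *: (gam l *m tv k i *m tv l i) + 2 *: (tv k l *m (gam i *m tv l i)))).
    rewrite !mulmx_sumr; apply: eq_bigr => i _.
    rewrite mulmxA cl_two_gam; last exact: tA.2.
    rewrite mulmxDl -mulmxA [_ *m (gam i *m _)]mulmxA cl_two_gam; last exact: tA.2.
    rewrite mulmxDl -[_ *m tau k *m _]mulmxA cl_two_vec; last exact: tA.2.
    rewrite !mulmxDr !mulmxA -!scalemxAr -!scalemxAl ?mulmxA; mx_ring.
  rewrite !big_split /= -!scaler_sumr -mulmx_suml -!mulmx_sumr.
  by rewrite sum_gam_cl_vec -!scalemxAr scalerA -natrM.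
rewrite mulmx_sumr; under eq_bigr do rewrite E1.
rewrite !big_split /= -!scaler_sumr -mulmx_suml.
have -> : \sum_l \sum_i gam l *m (gam i *m cl_vec (fun m => \sum_r t l i r * t k r m))
    = 2 *: \sum_r tau r *m tv k r.
  transitivity (\sum_l \sum_i \sum_r t l i r *: (gam l *m gam i *m tv k r)).
    apply: eq_bigr => l _; apply: eq_bigr => i _.
    rewrite -cl_vec_sum mulmxA mulmx_sumr; apply: eq_bigr => r _.
    by rewrite scalemxAr.
  under eq_bigr do rewrite exchange_big.
  rewrite exchange_big scaler_sumr; apply: eq_bigr => r _ /=.
  rewrite scalemxAl -sum_gam_cl_vec mulmx_suml; apply: eq_bigr => l _.
  rewrite [cl_vec (t r l)]cl_vecE mulmx_sumr mulmx_suml; apply: eq_bigr => i _.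
  by rewrite (alternating3_rot _ _ _ tA) -scalemxAr -scalemxAl.
have -> : \sum_l \sum_i gam l *m tv k i *m tv l i
    = 2 *: (\sum_i tv k i *m tau i) - 2 *: \sum_i \sum_l t k i l *: tv l i.
  rewrite exchange_big !scaler_sumr -sumrB; apply: eq_bigr => i _ /=.
  have -> : 2 *: (tv k i *m tau i) = - (tv k i *m \sum_l gam l *m tv l i).
    by rewrite sum_gam_tv -scalemxAr scaleNr opprK.
  rewrite mulmx_sumr scaler_sumr -sumrN -sumrB; apply: eq_bigr => l _.
  have -> : gam l *m tv k i = - (tv k i *m gam l) - (2 * t k i l) *: 1%:M.
    by rewrite cl_vecC; mx_ring.
  rewrite mulmxBl mulNmx mulmxA -scalemxAl mul1mx; mx_ring.
mx_ring.
Qed.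

(** Both 3 t = sum_k e_k t_k and 3 t = sum_k t_k e_k hold.  Using one for each half
    of 6 t t and the anticommutator of t with e_k gives - 2 sum_k t_k t_k up to the
    sum of the [t_k, t] e_k, which is computed from the expanded commutator. *)
Lemma cl_three_sqr :
  cl_three t *m cl_three t = - (\sum_k cl_two (t k) *m cl_two (t k))
    - (3^-1 * \sum_i \sum_j \sum_k t i j k ^+ 2) *: 1%:M.
Proof.
set N2 := \sum_i _; set S := \sum_k _; set Q := cl_three t.
have sqr : \sum_i \sum_k tv i k *m tv i k = - N2 *: 1%:M.
  under eq_bigr do (under eq_bigr do rewrite cl_vec_sqr; rewrite -scaler_suml sumrN).
  by rewrite -scaler_suml sumrN.
have tau_gam : \sum_k tau k *m gam k = 3 *: Q.
  rewrite -sum_gam_cl_two; apply: eq_bigr => k _.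
  rewrite cl_two_gam; last exact: tA.2.
  have -> : cl_vec (t k k) = 0; last by rewrite scaler0 addr0.
  rewrite cl_vecE big1 // => m _.
  by rewrite (@antisym_diag (fun i j => t i j m)) ?scale0r // => i j; rewrite tA.1.
have anti : 6 *: (Q *m Q) = - 2 *: S - \sum_k (tau k *m Q - Q *m tau k) *m gam k.
  transitivity ((3 *: Q) *m Q + Q *m (3 *: Q)).
    by rewrite -scalemxAl -scalemxAr; mx_ring.
  rewrite -tau_gam mulmx_suml mulmx_sumr -big_split /S scaler_sumr -sumrB.
  apply: eq_bigr => k _ /=.
  have -> : tau k *m gam k *m Q = - (tau k *m Q *m gam k) - 2 *: (tau k *m tau k).
    rewrite -!mulmxA cl_three_gam // mulmxBr mulmxN -scalemxAr; mx_ring.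
  rewrite mulmxBl mulmxA; mx_ring.
have comm : 6 *: (\sum_k (tau k *m Q - Q *m tau k) *m gam k)
    = 24 *: S + (12 * N2) *: 1%:M.
  transitivity (\sum_k (8 *: (\sum_i tv k i *m tau i *m gam k)
     + 4 *: (\sum_i tau i *m (tv k i *m gam k))
     - 4 *: (\sum_i \sum_l tv l i *m (t k i l *: gam k)))).
    rewrite scaler_sumr; apply: eq_bigr => k _.
    rewrite scalemxAl scalerBr (scalemxAr 6) (scalemxAl 6) cl_two_three_expand.
    rewrite -!addrA addrC -!addrA addNr addr0 addrA.
    rewrite !mulmxDl mulNmx -!scalemxAl !mulmx_suml.
    rewrite [RHS]addrA; congr (_ + _ *: _ - _ *: _); apply: eq_bigr => i _; rewrite ?mulmxA //.
    by rewrite mulmx_suml; apply: eq_bigr => l _; rewrite -scalemxAl -scalemxAr.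
  rewrite sumrB big_split /= -!scaler_sumr.
  have -> : \sum_k \sum_i tv k i *m tau i *m gam k = 2 *: S + (2 * N2) *: 1%:M.
    transitivity (\sum_i \sum_k (tv k i *m gam k *m tau i - 2 *: (tv i k *m tv i k))).
      rewrite exchange_big; apply: eq_bigr => i _; apply: eq_bigr => k _ /=.
      rewrite -mulmxA cl_two_gam; last exact: tA.2.
      rewrite mulmxDr mulmxA -scalemxAr; congr (_ + _).
      by rewrite [tv k i]tvC mulNmx scalerN.
    under eq_bigr do rewrite sumrB -scaler_sumr -mulmx_suml sum_tv_gam -scalemxAl.
    rewrite sumrB -!scaler_sumr sqr -/S; mx_ring.
  have -> : \sum_k \sum_i tau i *m (tv k i *m gam k) = 2 *: S.
    rewrite exchange_big scaler_sumr; apply: eq_bigr => i _ /=.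
    by rewrite -mulmx_sumr sum_tv_gam scalemxAr.
  have -> : \sum_k \sum_i \sum_l tv l i *m (t k i l *: gam k) = N2 *: 1%:M.
    rewrite -[RHS]opprK -scaleNr -sqr.
    under eq_bigr do rewrite exchange_big.
    rewrite exchange_big -sumrN; apply: eq_bigr => l _ /=.
    rewrite exchange_big -sumrN; apply: eq_bigr => i _ /=.
    rewrite -mulmx_sumr -mulmxN; congr (_ *m _).
    rewrite -tvC cl_vecE; apply: eq_bigr => k _.
    by rewrite (alternating3_rot _ _ _ tA) (alternating3_rot _ _ _ tA).
  mx_ring.
apply: (@scalerI _ _ 36); first by rewrite pnatr_eq0.
transitivity (6%:R *: (6%:R *: (Q *m Q))); first by mx_ring.
by rewrite anti scalerBr comm; mx_field.
Qed.
End ThreeFormSquare.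

(** The action of a 4-form: the 12 ordered pairs (i, j) inside a set of four indices
    each produce the same term. *)
Definition cl_four (f : 'I_n -> 'I_n -> 'I_n -> 'I_n -> K) : 'M[K]_N :=
  12^-1 *: \sum_i \sum_j gam i *m gam j *m cl_two (f i j).

(** With t i = nabla_(e_i) T this is the formula for dT in terms of a torsion free
    connection. *)
Definition alternation (t : 'I_n -> 'I_n -> 'I_n -> 'I_n -> K) i j k l :=
  t i j k l - t j i k l + t k i j l - t l i j k.

Lemma sum_gam_gam_cl_vec t :
  \sum_i \sum_j gam i *m gam j *m cl_vec (t i j) = 6 *: cl_three t.
Proof.
transitivity (\sum_i 2 *: (gam i *m cl_two (t i))).
  apply: eq_bigr => i _; rewrite scalemxAr -sum_gam_cl_vec mulmx_sumr.
  by apply: eq_bigr => j _; rewrite mulmxA.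
by rewrite -scaler_sumr sum_gam_cl_two; mx_ring.
Qed.

(** The product e_k t is e_k /\ t - e_k _| t.  Each of the four terms of the
    alternation gives the left-hand side after its gammas are reordered, and the
    reordering produces the contractions. *)
Lemma sum_gam_cl_three t : (forall k, alternating3 (t k)) ->
  \sum_k gam k *m cl_three (t k)
  = cl_four (alternation t) - \sum_k cl_two (t k k).
Proof.
move=> tA; set Q := LHS; set P := \sum_k cl_two _.
have T1 : \sum_k \sum_l gam k *m gam l *m cl_two (t k l) = 3 *: Q.
  rewrite scaler_sumr; apply: eq_bigr => k _.
  rewrite scalemxAr -sum_gam_cl_two mulmx_sumr.
  by apply: eq_bigr => l _; rewrite mulmxA.
have T2 : \sum_k \sum_l gam k *m gam l *m cl_two (t l k) = - 3 *: Q - 2 *: P.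
  transitivity (\sum_l \sum_k (- (gam l *m gam k *m cl_two (t l k))
      - 2 *: ((k == l)%:R *: cl_two (t l k)))).
    rewrite exchange_big; apply: eq_bigr => l _; apply: eq_bigr => k _ /=.
    rewrite gamC mulmxBl mulNmx -scalemxAl mul1mx; mx_ring.
  under eq_bigr do rewrite sumrB sumrN -scaler_sumr sum_deltar.
  by rewrite sumrB sumrN T1 -scaler_sumr scaleNr.
have Tgam : \sum_k cl_three (t k) *m gam k = - Q - 2 *: P.
  rewrite /Q /P scaler_sumr -sumrN -sumrB; apply: eq_bigr => k _.
  exact: cl_three_gam.
have T4 : \sum_k \sum_l gam k *m gam l *m cl_two (fun i j => t j k l i)
          = - 3 *: Q - 6 *: P.
  transitivity (3 *: \sum_k cl_three (t k) *m gam k); last by rewrite Tgam; mx_ring.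
  transitivity (2^-1 *: \sum_j (6 *: cl_three (t j)) *m gam j); last first.
    under eq_bigr do rewrite -scalemxAl.
    by rewrite -scaler_sumr; mx_field.
  transitivity (2^-1 *: \sum_j \sum_k \sum_l gam k *m gam l *m cl_vec (t j k l) *m gam j).
    rewrite [in RHS]exchange_big scaler_sumr; apply: eq_bigr => k _ /=.
    rewrite [in RHS]exchange_big scaler_sumr; apply: eq_bigr => l _ /=.
    rewrite cl_twoE -scalemxAr mulmx_sumr; congr (_ *: _).
    transitivity (\sum_i \sum_j t j k l i *: (gam k *m gam l *m gam i *m gam j)).
      apply: eq_bigr => i _; rewrite cl_vecE mulmxA mulmx_sumr.
      by apply: eq_bigr => j _; rewrite -scalemxAr.
    rewrite exchange_big; apply: eq_bigr => j _ /=.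
    rewrite cl_vecE mulmx_sumr mulmx_suml; apply: eq_bigr => i _.
    by rewrite -scalemxAr -scalemxAl.
  congr (_ *: _); apply: eq_bigr => j _; rewrite -sum_gam_gam_cl_vec mulmx_suml.
  by apply: eq_bigr => k _; rewrite mulmx_suml.
have T3 : \sum_k \sum_l gam k *m gam l *m cl_two (fun i j => t i k l j)
          = 3 *: Q + 4 *: P.
  transitivity (\sum_i (- (3 *: (cl_three (t i) *m gam i)) - 2 *: cl_two (t i i)));
    last by rewrite sumrB sumrN -!scaler_sumr Tgam; mx_ring.
  transitivity (\sum_i \sum_k \sum_l
     (- 2^-1 *: (gam k *m gam l *m cl_vec (t i k l) *m gam i)
       - t i i k l *: (gam k *m gam l))).
    rewrite [RHS]exchange_big; apply: eq_bigr => k _ /=.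
    rewrite [RHS]exchange_big; apply: eq_bigr => l _ /=.
    rewrite cl_twoE -scalemxAr mulmx_sumr scaler_sumr; apply: eq_bigr => i _.
    rewrite -!mulmxA cl_vecC !mulmxBr !mulmxN -!scalemxAr !mulmxA mulmx1.
    by rewrite (alternating3_rot k l i (tA i)); mx_field.
  apply: eq_bigr => i _; under eq_bigr do rewrite sumrB.
  rewrite sumrB; congr (_ - _).
    under eq_bigr do rewrite -scaler_sumr.
    rewrite -scaler_sumr.
    under eq_bigr do rewrite -mulmx_suml.
    by rewrite -mulmx_suml sum_gam_gam_cl_vec -scalemxAl; mx_field.
  rewrite -sum_gam_cl_vec; apply: eq_bigr => k _; rewrite cl_vecE mulmx_sumr.
  by apply: eq_bigr => l _; rewrite -scalemxAr.
rewrite /cl_four.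
have -> : \sum_k \sum_l gam k *m gam l *m cl_two (alternation t k l) =
   12 *: Q + 12 *: P.
  transitivity (3 *: Q - (- 3 *: Q - 2 *: P) + (3 *: Q + 4 *: P) - (- 3 *: Q - 6 *: P));
    last by mx_ring.
  rewrite -{1}T1 -{1}T2 -{1}T3 -{1}T4 -!sumrB -!big_split -!sumrB /=.
  apply: eq_bigr => k _; rewrite -sumrB -big_split -sumrB /=; apply: eq_bigr => l _.
  by rewrite -mulmxBr -mulmxDr -mulmxBr -!cl_twoN -!cl_twoD.
by mx_field.
Qed.

Lemma dirac_three_form q t (phi : 'I_n -> 'M[K]_(N, q)) b x :
  \sum_k gam k *m (phi k + b / 3 *: (cl_two (t k) *m x))
  = \sum_k gam k *m phi k + b *: (cl_three t *m x).
Proof.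
under eq_bigr do rewrite mulmxDr -scalemxAr mulmxA.
rewrite big_split /= -scaler_sumr -mulmx_suml sum_gam_cl_two -scalemxAl scalerA.
by congr (_ + _ *: _); field.
Qed.

Section Ricci.
Variable r : 'I_n -> 'I_n -> 'I_n -> 'I_n -> K.
Hypothesis r12 : forall i j k l, r i j k l = - r j i k l.
Hypothesis r34 : forall i j k l, r i j k l = - r i j l k.
Hypothesis bianchi : forall i j k l, r i j k l + r j k i l + r k i j l = 0.

Let ric i j := \sum_l r i l l j.

(** The contraction of the Bianchi identity over its last two indices. *)
Let ric_sym i j : ric i j = ric j i.
Proof.
have : \sum_l (r i j l l + r j l i l + r l i j l) = 0 by rewrite big1.
rewrite !big_split /= big1 ?add0r; last by move=> l _; apply: antisym_diag => ? ?; apply: r34.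
move/(canRL (addrK _)); rewrite sub0r => E.
rewrite [RHS]/ric; under [RHS]eq_bigr do rewrite r34.
rewrite sumrN E opprK; apply: eq_bigr => l _.
by rewrite r12 r34 opprK.
Qed.

(** Summing the Bianchi identity against e_i e_j e_k and bringing the three cyclic
    permutations of this product to the same order shows that
    sum r_ijkl e_i e_j e_k equals - 2 sum_i ric_il e_i.  Multiplying by e_l leaves the
    trace of the Ricci tensor, which is symmetric. *)
Lemma sum_gam_curvature :
  \sum_i \sum_j gam i *m gam j *m cl_two (r i j)
  = (\sum_i \sum_j r i j j i) *: 1%:M.
Proof.
set X := LHS.
pose F i j k := gam i *m gam j *m gam k.
have X2 : 2 *: X = \sum_i \sum_j \sum_k F i j k *m cl_vec (r i j k).
  rewrite scaler_sumr; apply: eq_bigr => i _.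
  rewrite scaler_sumr; apply: eq_bigr => j _.
  rewrite scalemxAr -sum_gam_cl_vec mulmx_sumr.
  by apply: eq_bigr => k _; rewrite mulmxA.
have Fik i j k : F k i j = F i j k - (2 * (k == i)%:R) *: gam j
                 + (2 * (k == j)%:R) *: gam i.
  rewrite /F gamC mulmxBl mulNmx -!mulmxA [gam k *m gam j]gamC mulmxBr mulmxN !mulmxA.
  rewrite -scalemxAl -scalemxAr mul1mx mulmx1; mx_ring.
have Fjk i j k : F j k i = F i j k - (2 * (k == i)%:R) *: gam j
                 + (2 * (j == i)%:R) *: gam k.
  rewrite /F -mulmxA gamC mulmxBr mulmxN mulmxA [gam j *m gam i]gamC mulmxBl mulNmx.
  rewrite -scalemxAl -scalemxAr mul1mx mulmx1; mx_ring.
have tr : \sum_i gam i *m cl_vec (ric i) = - (\sum_i \sum_j r i j j i) *: 1%:M.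
  suff : 2 *: (\sum_i gam i *m cl_vec (ric i))
     = 2 *: (- (\sum_i \sum_j r i j j i) *: 1%:M).
    by apply: scalerI; rewrite pnatr_eq0.
  have E : \sum_i gam i *m cl_vec (ric i) = \sum_i cl_vec (ric i) *m gam i.
    under eq_bigr do rewrite cl_vecE mulmx_sumr.
    rewrite exchange_big; apply: eq_bigr => i _ /=; rewrite cl_vecE mulmx_suml.
    by apply: eq_bigr => j _; rewrite -scalemxAr -scalemxAl ric_sym.
  transitivity (\sum_i (gam i *m cl_vec (ric i) + cl_vec (ric i) *m gam i)).
    by rewrite big_split /= -E scalerDl scale1r.
  rewrite scalerA mulrN -mulNr mulr_sumr scaler_suml; apply: eq_bigr => i _.
  rewrite cl_vecC /ric; mx_ring.
have cyc : \sum_i \sum_j \sum_k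
    (F i j k *m cl_vec (r i j k) + F k i j *m cl_vec (r i j k)
     + F j k i *m cl_vec (r i j k)) = 0.
  transitivity (\sum_i \sum_j \sum_k F i j k *m
     (cl_vec (r i j k) + cl_vec (r j k i) + cl_vec (r k i j))); last first.
    rewrite big1 // => i _; rewrite big1 // => j _; rewrite big1 // => k _.
    rewrite -!cl_vecD cl_vecE big1 ?mulmx0 // => l _.
    by rewrite bianchi scale0r.
  pose G i j k := F i j k *m cl_vec (r j k i).
  pose H i j k := F i j k *m cl_vec (r k i j).
  transitivity (\sum_i \sum_j \sum_k F i j k *m cl_vec (r i j k) +
     \sum_i \sum_j \sum_k G k i j + \sum_i \sum_j \sum_k H j k i).
    rewrite -!big_split; apply: eq_bigr => i _; rewrite -!big_split.
    by apply: eq_bigr => j _; rewrite -!big_split.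
  have -> : \sum_i \sum_j \sum_k G k i j = \sum_i \sum_j \sum_k G i j k.
    by under eq_bigr do rewrite exchange_big; rewrite exchange_big.
  have -> : \sum_i \sum_j \sum_k H j k i = \sum_i \sum_j \sum_k H i j k.
    by rewrite exchange_big; under eq_bigr do rewrite exchange_big.
  rewrite -!big_split; apply: eq_bigr => i _; rewrite -!big_split.
  by apply: eq_bigr => j _; rewrite -!big_split; apply: eq_bigr => k _; rewrite /= !mulmxDr.
have : 3 *: (2 *: X) + 6 *: \sum_i gam i *m cl_vec (ric i) = 0.
  rewrite X2 -[RHS]cyc.
  have ricE i : cl_vec (ric i) = \sum_j cl_vec (r i j j).
    under eq_bigr do rewrite -[cl_vec _]scale1r.
    by rewrite cl_vec_sum; apply: eq_cl_vec => l; apply: eq_bigr => j _; rewrite mul1r.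
  have Sl : \sum_i \sum_j \sum_k (k == i)%:R *: (gam j *m cl_vec (r i j k)) =
      - \sum_i gam i *m cl_vec (ric i).
    rewrite exchange_big -sumrN; apply: eq_bigr => j _ /=.
    rewrite -mulmxN ricE -sumrN mulmx_sumr; apply: eq_bigr => i _.
    by rewrite sum_deltar -cl_vecN; congr (_ *m _); apply: eq_cl_vec => l.
  have Sr : \sum_i \sum_j \sum_k (k == j)%:R *: (gam i *m cl_vec (r i j k)) =
      \sum_i gam i *m cl_vec (ric i).
    apply: eq_bigr => i _; rewrite ricE mulmx_sumr; apply: eq_bigr => j _.
    by rewrite sum_deltar.
  have S0 : \sum_i \sum_j \sum_k (j == i)%:R *: (gam k *m cl_vec (r i j k)) = 0.
    rewrite big1 // => i _; rewrite exchange_big big1 // => k _ /=.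
    rewrite sum_deltar cl_vecE big1 ?mulmx0 // => l _.
    by rewrite (@antisym_diag (fun i j => r i j k l)) ?scale0r.
  transitivity (3 *: (\sum_i \sum_j \sum_k F i j k *m cl_vec (r i j k))
    - 4 *: (\sum_i \sum_j \sum_k (k == i)%:R *: (gam j *m cl_vec (r i j k)))
    + 2 *: (\sum_i \sum_j \sum_k (k == j)%:R *: (gam i *m cl_vec (r i j k)))
    + 2 *: (\sum_i \sum_j \sum_k (j == i)%:R *: (gam k *m cl_vec (r i j k)))).
    rewrite Sl Sr S0; mx_ring.
  rewrite !scaler_sumr -sumrB -!big_split; apply: eq_bigr => i _ /=.
  rewrite !scaler_sumr -sumrB -!big_split; apply: eq_bigr => j _ /=.
  rewrite !scaler_sumr -sumrB -!big_split; apply: eq_bigr => k _ /=.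
  rewrite (Fik i j k) (Fjk i j k) !mulmxDl !mulNmx -!scalemxAl; mx_ring.
rewrite tr => /eqP; rewrite addr_eq0 => /eqP E.
apply: (@scalerI _ _ 6); first by rewrite pnatr_eq0.
transitivity (3%:R *: (2%:R *: X)); first by mx_ring.
by rewrite E; mx_ring.
Qed.
End Ricci.

Lemma eq_cl_three u t : (forall i j k, u i j k = t i j k) -> cl_three u = cl_three t.
Proof.
move=> ut; rewrite !cl_threeE; congr (_ *: _); apply: eq_bigr => i _.
by rewrite (eq_cl_two (ut i)).
Qed.

Lemma cl_threeD u t :
  cl_three (fun i j k => u i j k + t i j k) = cl_three u + cl_three t.
Proof.
rewrite !cl_threeE -scalerDr -big_split; congr (_ *: _); apply: eq_bigr => i _.
by rewrite cl_twoD mulmxDr.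
Qed.

(** The spin lift of w in so(n); the factor makes it a Lie algebra morphism, acting
    on vectors by [cl_spin_gam]. *)
Definition cl_spin (w : 'I_n -> 'I_n -> K) : 'M[K]_N := locked (2^-1 *: cl_two w).

Lemma cl_spinE w : cl_spin w = 2^-1 *: cl_two w.
Proof. by rewrite /cl_spin -lock. Qed.

Lemma eq_cl_spin w v : (forall i j, w i j = v i j) -> cl_spin w = cl_spin v.
Proof. by move=> wv; rewrite !cl_spinE (eq_cl_two wv). Qed.

Lemma cl_spinD w v : cl_spin (fun i j => w i j + v i j) = cl_spin w + cl_spin v.
Proof. by rewrite !cl_spinE cl_twoD scalerDr. Qed.

Lemma cl_spinN w : cl_spin (fun i j => - w i j) = - cl_spin w.
Proof. by rewrite !cl_spinE cl_twoN scalerN. Qed.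

Lemma cl_spin_comb a b c d : cl_spin a - cl_spin b - cl_spin c + cl_spin d
  = cl_spin (fun i j => a i j - b i j - c i j + d i j).
Proof. by rewrite -!cl_spinN -!cl_spinD. Qed.

Lemma cl_spin_sum (J : finType) (a : J -> K) (w : J -> 'I_n -> 'I_n -> K) :
  \sum_l a l *: cl_spin (w l) = cl_spin (fun i j => \sum_l a l * w l i j).
Proof.
rewrite cl_spinE -cl_two_sum scaler_sumr; apply: eq_bigr => l _.
by rewrite cl_spinE !scalerA mulrC.
Qed.

Lemma cl_spin_gam w l : antisym w ->
  cl_spin w *m gam l - gam l *m cl_spin w = cl_vec (w l).
Proof.
move=> wA; rewrite cl_spinE -scalemxAl -scalemxAr cl_two_gam //; by mx_field.
Qed.

Lemma cl_spin_two w v : antisym w ->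
  cl_spin w *m cl_two v - cl_two v *m cl_spin w =
  cl_two (fun i j => \sum_m (w m i * v m j + v i m * w m j)).
Proof.
move=> wA; rewrite cl_spinE -scalemxAl -scalemxAr -scalerBr cl_two_comm //; by mx_field.
Qed.

Lemma cl_spin_spin w v : antisym w ->
  cl_spin w *m cl_spin v - cl_spin v *m cl_spin w =
  cl_spin (fun i j => \sum_m (w m i * v m j + v i m * w m j)).
Proof.
move=> wA; rewrite (cl_spinE v) -scalemxAl -scalemxAr -scalerBr cl_spin_two //.
by rewrite cl_spinE.
Qed.

Lemma cl_spin_three w t : antisym w ->
  cl_spin w *m cl_three t - cl_three t *m cl_spin w =
  cl_three (fun i j k =>
    \sum_m (w m i * t m j k + w m j * t i m k + w m k * t i j m)).
Proof.
move=> wA; rewrite cl_spinE -scalemxAl -scalemxAr -scalerBr cl_two_three_comm //.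
by mx_field.
Qed.

Lemma sum_ltn_cl_two w : antisym w ->
  \sum_(i < n) \sum_(j < n | (i < j)%N) w i j *: (gam i *m gam j) = cl_two w.
Proof.
move=> wA.
have w0 i : w i i = 0 by exact: antisym_diag.
rewrite cl_twoE.
have -> : \sum_i gam i *m cl_vec (w i) = \sum_i \sum_j w i j *: (gam i *m gam j).
  apply: eq_bigr => i _; rewrite cl_vecE mulmx_sumr.
  by apply: eq_bigr => j _; rewrite -scalemxAr.
rewrite sum_ltn2 => [|i j|i]; last by rewrite w0 scale0r.
  by rewrite -[X in _ *: X]scaler_nat scalerA mulVf ?scale1r // pnatr_eq0.
have [->//|ij] := eqVneq i j.
by rewrite gamC (negPf ij) mulr0 scale0r subr0 wA scalerN scaleNr opprK.
Qed.

Lemma sum_ltn_cl_four (f : 'I_n -> 'I_n -> 'I_n -> 'I_n -> K) :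
  (forall i j k l, f i j k l = - f j i k l) ->
  (forall i j k l, f i j k l = - f i k j l) ->
  (forall i j k l, f i j k l = - f i j l k) ->
  \sum_(i < n) \sum_(j < n | (i < j)%N) \sum_(k < n | (j < k)%N)
    \sum_(l < n | (k < l)%N)
      f i j k l *: (gam i *m gam j *m gam k *m gam l) = cl_four f.
Proof.
move=> f12 f23 f34; rewrite /cl_four.
have -> : \sum_i \sum_j gam i *m gam j *m cl_two (f i j) = 2^-1 *:
   \sum_i \sum_j \sum_k \sum_l f i j k l *: (gam i *m gam j *m gam k *m gam l).
  rewrite scaler_sumr; apply: eq_bigr => i _.
  rewrite scaler_sumr; apply: eq_bigr => j _.
  rewrite cl_twoE -scalemxAr mulmx_sumr; congr (_ *: _); apply: eq_bigr => k _.
  rewrite cl_vecE mulmxA mulmx_sumr; apply: eq_bigr => l _.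
  by rewrite -scalemxAr.
have anti i j : i != j -> gam i *m gam j = - (gam j *m gam i).
  by move=> ij; rewrite gamC (negPf ij) mulr0 scale0r subr0.
rewrite sum_ltn4 => [|i j k l|i j k l|i j k l|i k l].
- rewrite -[X in 12^-1 *: (_ *: X)]scaler_nat !scalerA (_ : _ * _ * _ = 1) ?scale1r //.
  by field.
- have [->//|ij] := eqVneq i j.
  by rewrite f12 (anti i j) // !mulNmx scalerN scaleNr opprK.
- have [->//|jk] := eqVneq j k.
  by rewrite f23 -2!mulmxA [gam j *m _]mulmxA (anti j k) // !mulNmx !mulmxN !mulmxA
    scalerN scaleNr opprK.
- have [->//|kl] := eqVneq k l.
  by rewrite f34 -mulmxA (anti k l) // mulmxN !mulmxA scalerN scaleNr opprK.
- by rewrite (@antisym_diag (fun i j => f i j k l)) ?scale0r.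
Qed.

Section AtPoint.
Variables (q : nat) (psi : 'M[K]_(N, q)) (phi : 'I_n -> 'M[K]_(N, q)).
Variables (H : 'I_n -> 'I_n -> 'M[K]_(N, q)).
Variables (w : 'I_n -> 'I_n -> 'I_n -> K) (r : 'I_n -> 'I_n -> 'I_n -> 'I_n -> K).
Hypothesis wA : forall k, antisym (w k).
Hypothesis r12 : forall i j k l, r i j k l = - r j i k l.
Hypothesis r34 : forall i j k l, r i j k l = - r i j l k.
Hypothesis bianchi : forall i j k l, r i j k l + r j k i l + r k i j l = 0.

Let hess k l := H k l - \sum_m w k l m *: phi m.

Hypothesis curv : forall k l,
  hess k l - hess l k = cl_spin (r k l) *m psi.

(** H k l stands for nabla_k nabla_l psi and phi l for nabla_l psi, so that
    hess is the second covariant derivative and the left-hand side is D D psi.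
    By antisymmetry of w it equals sum e_k e_l hess_kl; the symmetric part of the
    product e_k e_l gives the Laplacian, the antisymmetric part the curvature. *)
Lemma lichnerowicz_at :
  \sum_k gam k *m (\sum_l (gam l *m H k l + cl_vec (w k l) *m phi l))
  = - (\sum_k (H k k - \sum_m w k k m *: phi m))
    + (4^-1 * \sum_i \sum_j r i j j i) *: psi.
Proof.
set S := \sum_k (_ - _).
have -> : \sum_k gam k *m (\sum_l (gam l *m H k l + cl_vec (w k l) *m phi l))
    = \sum_k \sum_l gam k *m gam l *m hess k l.
  apply: eq_bigr => k _; rewrite big_split /= mulmxDr.
  have -> : \sum_l cl_vec (w k l) *m phi l = - \sum_l gam l *m \sum_m w k l m *: phi m.
    under eq_bigr do rewrite cl_vecE mulmx_suml.
    rewrite exchange_big -sumrN; apply: eq_bigr => l _ /=.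
    rewrite mulmx_sumr -sumrN; apply: eq_bigr => m _.
    by rewrite -scalemxAl -scalemxAr wA scaleNr.
  rewrite mulmxN !mulmx_sumr -sumrB; apply: eq_bigr => l _.
  by rewrite mulmxBr !mulmxA.
set X := LHS.
apply: (@scalerI _ _ 2); first by rewrite pnatr_eq0.
(* Twice the sum, the second copy with k and l exchanged. *)
transitivity (\sum_k \sum_l gam k *m gam l *m (hess k l - hess l k) - 2 *: S).
  transitivity (X + \sum_k \sum_l gam l *m gam k *m hess l k).
    by rewrite -[X in _ + X]exchange_big -/X; mx_ring.
  rewrite /X scaler_sumr -big_split -sumrB; apply: eq_bigr => k _ /=.
  rewrite -/(hess k k) -(sum_deltal (fun l => hess l k)) scaler_sumr -big_split -sumrB.
  apply: eq_bigr => l _ /=.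
  rewrite [gam l *m gam k]gamC mulmxBl mulNmx (mulmxBr _ (hess k l)) -scalemxAl mul1mx eq_sym.
  mx_ring.
have -> : \sum_k \sum_l gam k *m gam l *m (hess k l - hess l k) =
    2^-1 *: (\sum_k \sum_l gam k *m gam l *m cl_two (r k l)) *m psi.
  rewrite -scalemxAl mulmx_suml scaler_sumr; apply: eq_bigr => k _.
  rewrite mulmx_suml scaler_sumr; apply: eq_bigr => l _.
  by rewrite curv cl_spinE -scalemxAl -scalemxAr !mulmxA.
by rewrite sum_gam_curvature // -!scalemxAl mul1mx; mx_field.
Qed.

Variables (t : 'I_n -> 'I_n -> 'I_n -> K) (nt : 'I_n -> 'I_n -> 'I_n -> 'I_n -> K).
Hypothesis tA : alternating3 t.
Hypothesis ntA : forall k, alternating3 (nt k).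
Variable s : K.

(** The whole computation at a point: nt k is nabla_k T, the left-hand side is
    D^(s/3) applied to D psi + s T psi, and the first sum on the right is minus the
    Laplacian of nabla^s. *)
Lemma dirac_square_at :
  \sum_k gam k *m ((\sum_l (gam l *m H k l + cl_vec (w k l) *m phi l))
       + s *: (cl_three t *m phi k + cl_three (nt k) *m psi))
    + s *: (cl_three t *m (\sum_k gam k *m phi k + s *: (cl_three t *m psi)))
  = - (\sum_k (H k k + s *: (cl_two (t k) *m phi k
                + (cl_two (nt k k) + \sum_m w k k m *: cl_two (t m)) *m psi)
           + s *: (cl_two (t k) *m (phi k + s *: (cl_two (t k) *m psi)))
           - \sum_m w k k m *: (phi m + s *: (cl_two (t m) *m psi))))
    + s *: (cl_four (alternation nt) *m psi)
    + (4^-1 * \sum_i \sum_j r i j j i) *: psi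
    - (2 * s ^+ 2 * (6^-1 * \sum_i \sum_j \sum_k t i j k ^+ 2)) *: psi.
Proof.
set N2 := \sum_i \sum_j \sum_k t i j k ^+ 2; set Q := cl_three t.
set L := \sum_k (H k k - \sum_m w k k m *: phi m).
have anti : \sum_k gam k *m (Q *m phi k) + Q *m (\sum_k gam k *m phi k)
    = - 2 *: \sum_k cl_two (t k) *m phi k.
  rewrite mulmx_sumr -big_split scaler_sumr; apply: eq_bigr => k _ /=.
  rewrite !mulmxA cl_three_gam // mulmxBl mulNmx -scalemxAl; mx_ring.
have div : \sum_k gam k *m (cl_three (nt k) *m psi)
    = cl_four (alternation nt) *m psi - \sum_k cl_two (nt k k) *m psi.
  transitivity ((\sum_k gam k *m cl_three (nt k)) *m psi).
    by rewrite mulmx_suml; apply: eq_bigr => k _; rewrite mulmxA.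
  by rewrite sum_gam_cl_three // mulmxBl mulmx_suml.
have sqr : Q *m (Q *m psi) = - (\sum_k cl_two (t k) *m (cl_two (t k) *m psi))
    - (3^-1 * N2) *: psi.
  rewrite mulmxA cl_three_sqr // mulmxBl mulNmx mulmx_suml -scalemxAl mul1mx.
  by congr (- _ - _); apply: eq_bigr => k _; rewrite mulmxA.
transitivity (- L + (4^-1 * \sum_i \sum_j r i j j i) *: psi
   + s *: (- 2 *: (\sum_k cl_two (t k) *m phi k) + (cl_four (alternation nt) *m psi
      - \sum_k cl_two (nt k k) *m psi)) + (s * s) *: (Q *m (Q *m psi))).
  rewrite -lichnerowicz_at -anti -div.
  under eq_bigr do rewrite mulmxDr -scalemxAr mulmxDr.
  rewrite big_split /= -scaler_sumr big_split /= mulmxDr -scalemxAr; mx_ring.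
rewrite sqr.
suff -> : \sum_k (H k k + s *: (cl_two (t k) *m phi k
                + (cl_two (nt k k) + \sum_m w k k m *: cl_two (t m)) *m psi)
           + s *: (cl_two (t k) *m (phi k + s *: (cl_two (t k) *m psi)))
           - \sum_m w k k m *: (phi m + s *: (cl_two (t m) *m psi))) =
   L + (2 * s) *: (\sum_k cl_two (t k) *m phi k) + s *: (\sum_k cl_two (nt k k) *m psi)
   + (s * s) *: (\sum_k cl_two (t k) *m (cl_two (t k) *m psi)) by mx_field.
rewrite /L !scaler_sumr -!big_split; apply: eq_bigr => k _ /=.
have -> : \sum_m w k k m *: (phi m + s *: (cl_two (t m) *m psi)) =
   \sum_m w k k m *: phi m + s *: ((\sum_m w k k m *: cl_two (t m)) *m psi).
  rewrite mulmx_suml scaler_sumr -big_split; apply: eq_bigr => m _ /=.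
  rewrite -scalemxAl; mx_ring.
rewrite mulmxDl mulmxDr -scalemxAr; mx_ring.
Qed.
End AtPoint.

End Clifford.

(** * Smooth functions on open sets *)

Section SmoothFunctions.
Context {R : realType} {n : nat}.
Implicit Types (U : set 'rV[R]_n) (f g : 'rV[R]_n -> R).

Lemma near_line U x (v : 'rV[R]_n) : open U -> U x ->
  \forall h \near (0 : R)^', U (h *: v + x).
Proof.
move=> oU Ux; have Unx : nbhs x U by exact: open_nbhs_nbhs.
have : \forall z \near (0 : 'rV[R]_n), (U \o shift (x - 0)) z by rewrite -near_shift.
by rewrite subr0 => /(near0Z v); exact: nbhs_dnbhs.
Qed.

(** Derivatives at a point of an open set depend only on the values on this set. *)
Lemma cvg_quotient_eq U f g x v : open U -> U x -> (forall y, U y -> f y = g y) ->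
  (fun h => h^-1 *: ((f \o shift x) (h *: v) - f x)) @ (0 : R)^' `=>`
  (fun h => h^-1 *: ((g \o shift x) (h *: v) - g x)) @ (0 : R)^'.
Proof.
move=> oU Ux fg; apply: near_eq_cvg.
near=> h; rewrite /= !fg //; near: h; exact: near_line.
Unshelve. all: by end_near. Qed.

Lemma continuous_eq_on U f g x : open U -> U x -> (forall y, U y -> f y = g y) ->
  {for x, continuous f} -> {for x, continuous g}.
Proof.
move=> oU Ux fg cf.
suff : g y @[y --> x] --> g x by [].
rewrite -fg //; apply: cvg_trans cf; apply: (@near_eq_cvg _ _ (nbhs x) _ f g).
have : nbhs x U by exact: open_nbhs_nbhs.
by apply: filterS => y; exact: fg.
Qed.

Lemma derivable_eq_on U f g x v : open U -> U x -> (forall y, U y -> f y = g y) ->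
  derivable f x v -> derivable g x v.
Proof.
move=> oU Ux fg /cvg_ex [l fl]; apply/cvg_ex; exists l.
apply: cvg_trans fl; apply: (@cvg_quotient_eq U g f x v) => // y Uy.
by rewrite fg.
Qed.

Lemma derive_eq_on U f g x v : open U -> U x -> (forall y, U y -> f y = g y) ->
  'D_v f x = 'D_v g x.
Proof.
move=> oU Ux fg; rewrite /derive; congr (lim _).
apply/seteqP; split; last exact: (@cvg_quotient_eq U f g x v).
by apply: (@cvg_quotient_eq U g f x v) => // y Uy; rewrite fg.
Qed.

Lemma Ck_eq_on k U f g : open U -> (forall x, U x -> f x = g x) ->
  Ck k U f -> Ck k U g.
Proof.
move=> oU; elim: k f g => [|k IH] f g fg /= [cf df].
all: have cg x : U x -> {for x, continuous g} by move=> Ux;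
  apply: (continuous_eq_on oU Ux fg); exact: cf.
  by split.
split=> // i; have [dfi Cfi] := df i; split.
  by move=> x Ux; apply: (@derivable_eq_on U f g) => //; exact: dfi.
by apply: IH Cfi => x Ux; apply: (@derive_eq_on U).
Qed.

Lemma Ck_subset k U U' f : U' `<=` U -> Ck k U f -> Ck k U' f.
Proof.
move=> UU'; elim: k f => [|k IH] f /= [cf df]; split=> //.
1,2: by move=> x /UU'; apply: cf.
move=> i; have [dfi Cfi] := df i; split; last exact: IH.
by move=> x /UU'; apply: dfi.
Qed.

Lemma CkS k U f : Ck k.+1 U f -> Ck k U f.
Proof.
elim: k f => [|k IH] f /= [cf df]; split=> // i.
by have [dfi Cfi] := df i; split=> //; apply: IH.
Qed.

Lemma Ck_cst k U (c : R) : Ck k U (fun=> c).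
Proof.
elim: k c => [|k IH] c /=; split=> //; try by move=> x _; exact: cst_continuous.
move=> i; split; first by move=> x _; exact: (derivable_cst c).
have -> : 'D_(delta_mx 0 i) (fun=> c) = (fun=> 0) :> ('rV[R]_n -> R).
  by apply/funext => x; rewrite (derive_cst c).
exact: IH.
Qed.

Lemma CkD k U f g : open U -> Ck k U f -> Ck k U g -> Ck k U (fun x => f x + g x).
Proof.
move=> oU; elim: k f g => [|k IH] f g /= [cf df] [cg dg].
all: split=> //; try by move=> x Ux; apply: continuousD; [exact: cf|exact: cg].
move=> i; have [dfi Cfi] := df i; have [dgi Cgi] := dg i.
split=> [x Ux|]; first by apply: derivableD; [exact: dfi|exact: dgi].
apply: Ck_eq_on (IH _ _ Cfi Cgi) => // x Ux.
by rewrite deriveD //; [exact: dfi|exact: dgi].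
Qed.

(** Class C^(k+1) is the class C^k of the derivatives, so the product rule gives the
    induction step. *)
Lemma CkM k U f g : open U -> Ck k U f -> Ck k U g -> Ck k U (fun x => f x * g x).
Proof.
move=> oU; elim: k f g => [|k IH] f g Cf Cg.
all: have [cf df] := Cf; have [cg dg] := Cg.
all: split=> //; try by move=> x Ux; apply: continuousM; [exact: cf|exact: cg].
move=> i; have [dfi Cfi] := df i; have [dgi Cgi] := dg i.
split=> [x Ux|]; first by apply: derivableM; [exact: dfi|exact: dgi].
apply: (@Ck_eq_on k U (fun x => f x * 'D_(delta_mx 0 i) g x
  + g x * 'D_(delta_mx 0 i) f x)) => // [x Ux|].
  by rewrite deriveM //; [exact: dfi|exact: dgi].
by apply: CkD => //; apply: IH => //; exact: CkS.
Qed.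

End SmoothFunctions.

(** * Derivations and matrix valued functions *)

Section Manifold.
Context {R : realType} {n : nat} {M : topologicalType}.
Variable (A : set (chart R n M)).
Hypothesis hM : smooth_manifold A.
Implicit Types (W : set M) (f h : M -> R) (p : M).

Lemma chart_img_open c W : A c -> open W -> open (chart_img c W).
Proof.
move=> Ac oW; have hc := atlas_chart hM Ac.
rewrite openE => x [q [Wq cq] <-].
have Tx : chart_img c setT (chart_map c q) by exists q.
have N1 : nbhs (chart_map c q) (chart_img c setT).
  by apply: open_nbhs_nbhs; split=> //; exact: chart_img_open hc.
have N2 : nbhs (chart_map c q) (chart_inv c @^-1` W).
  apply: (chart_inv_cont hc Tx); apply: open_nbhs_nbhs; split=> //.
  by rewrite chart_mapK.
apply: filterS2 N1 N2 => y [q' [_ cq'] <-] /=; rewrite (chart_mapK hc) // => Wq'.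
by exists q'.
Qed.

Lemma smooth_on_eq W f h : open W -> (forall q, W q -> f q = h q) ->
  smooth_on A W f -> smooth_on A W h.
Proof.
move=> oW fh sf c Ac k; apply: Ck_eq_on (sf c Ac k); first exact: chart_img_open.
by move=> x [q [Wq cq] <-]; rewrite (chart_mapK (atlas_chart hM Ac)) // fh.
Qed.

Lemma smooth_on_subset W W' f : W' `<=` W -> smooth_on A W f -> smooth_on A W' f.
Proof.
move=> WW' sf c Ac k; apply: Ck_subset (sf c Ac k).
by move=> x [q [Wq cq] <-]; exists q => //; split=> //; exact: WW'.
Qed.

Lemma smooth_on_cst W (a : R) : smooth_on A W (fun=> a).
Proof. by move=> c Ac k; exact: Ck_cst. Qed.

Lemma smooth_onD W f h : open W -> smooth_on A W f -> smooth_on A W h ->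
  smooth_on A W (fun q => f q + h q).
Proof.
move=> oW sf sh c Ac k; apply: CkD (sf c Ac k) (sh c Ac k); exact: chart_img_open.
Qed.

Lemma smooth_onM W f h : open W -> smooth_on A W f -> smooth_on A W h ->
  smooth_on A W (fun q => f q * h q).
Proof.
move=> oW sf sh c Ac k; apply: CkM (sf c Ac k) (sh c Ac k); exact: chart_img_open.
Qed.

Lemma smooth_onN W f : open W -> smooth_on A W f -> smooth_on A W (fun q => - f q).
Proof.
move=> oW sf; apply: (@smooth_on_eq W (fun q => -1 * f q)) => //.
  by move=> q _; rewrite mulN1r.
by apply: smooth_onM => //; exact: smooth_on_cst.
Qed.

Lemma smooth_onB W f h : open W -> smooth_on A W f -> smooth_on A W h ->
  smooth_on A W (fun q => f q - h q).
Proof. by move=> oW sf sh; apply: smooth_onD => //; exact: smooth_onN. Qed.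

Lemma smooth_on_near W p f : open W -> W p -> smooth_on A W f -> smooth_near A p f.
Proof. by move=> oW Wp sf; exists W. Qed.

Section Derivation.
Variables (p : M) (v : tvec R M).
Hypothesis vp : tangent A p v.

Lemma tangentD f h : smooth_near A p f -> smooth_near A p h ->
  v (fun q => f q + h q) = v f + v h.
Proof.
move=> sf sh; rewrite -[v f]mul1r -(tangent_linear vp) //.
by congr v; apply/funext => q; rewrite mul1r.
Qed.

(** From 1 = 1 * 1 and the Leibniz rule. *)
Lemma tangent_cst (a : R) : v (fun=> a) = 0.
Proof.
have s1 b : smooth_near A p (fun=> b).
  by exists setT; split=> //; [exact: openT|exact: smooth_on_cst].
have v1 : v (fun=> 1) = 0.
  have := tangent_leibniz vp (s1 1) (s1 1); rewrite !mulr1 mul1r.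
  by move/eqP; rewrite -subr_eq0 opprD addrA subrr sub0r oppr_eq0 => /eqP.
have v0 : v (fun=> 0) = 0.
  have := tangentD (s1 0) (s1 0); rewrite addr0.
  by move/eqP; rewrite -subr_eq0 opprD addrA subrr sub0r oppr_eq0 => /eqP.
have := tangent_linear vp a (s1 1) (s1 0); by rewrite v1 v0 mulr0 !addr0 mulr1 => <-.
Qed.

Lemma tangentN f : smooth_near A p f -> v (fun q => - f q) = - v f.
Proof.
move=> sf.
have s0 : smooth_near A p (fun=> 0).
  by exists setT; split=> //; [exact: openT|exact: smooth_on_cst].
have := tangent_linear vp (-1) sf s0; rewrite tangent_cst addr0 mulN1r => <-.
by congr v; apply/funext => q; rewrite addr0 mulN1r.
Qed.

Lemma tangent_eq_on W f h : open W -> W p -> (forall q, W q -> f q = h q) ->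
  v f = v h.
Proof.
move=> oW Wp fh; apply: (tangent_germ vp).
by apply: filterS (open_nbhs_nbhs (conj oW Wp)) => q /fh.
Qed.

End Derivation.

Definition dcomplex (v : tvec R M) (f : M -> R[i]) : R[i] :=
  v (fun q => complex.Re (f q)) +i* v (fun q => complex.Im (f q)).

Definition dmatrix a b (v : tvec R M) (F : M -> 'M[R[i]]_(a, b)) : 'M[R[i]]_(a, b) :=
  locked (\matrix_(i, j) dcomplex v (fun q => F q i j)).

Lemma dmatrixE a b v (F : M -> 'M[R[i]]_(a, b)) i j :
  dmatrix v F i j = dcomplex v (fun q => F q i j).
Proof. by rewrite /dmatrix -lock mxE. Qed.

Definition smooth_mx a b W (F : M -> 'M[R[i]]_(a, b)) :=
  forall i j, smooth_onC A W (fun q => F q i j).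

Lemma ReD (x y : R[i]) : complex.Re (x + y) = complex.Re x + complex.Re y.
Proof. by case: x; case: y. Qed.
Lemma ImD (x y : R[i]) : complex.Im (x + y) = complex.Im x + complex.Im y.
Proof. by case: x; case: y. Qed.
Lemma ReM (x y : R[i]) : complex.Re (x * y) =
  complex.Re x * complex.Re y - complex.Im x * complex.Im y.
Proof. by case: x; case: y. Qed.
Lemma ImM (x y : R[i]) : complex.Im (x * y) =
  complex.Re x * complex.Im y + complex.Im x * complex.Re y.
Proof. by case: x; case: y. Qed.

Section Matrix.
Variable W : set M.
Hypothesis oW : open W.

Let eq_smooth_on f h : f =1 h -> smooth_on A W f -> smooth_on A W h.
Proof. by move=> /funext ->. Qed.

Let eq_smooth_onC (f h : M -> R[i]) : f =1 h -> smooth_onC A W f -> smooth_onC A W h.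
Proof. by move=> /funext ->. Qed.

Lemma smooth_onC_cst (z : R[i]) : smooth_onC A W (fun=> z).
Proof. by split; exact: smooth_on_cst. Qed.

Lemma smooth_onCD (f h : M -> R[i]) : smooth_onC A W f -> smooth_onC A W h ->
  smooth_onC A W (fun q => f q + h q).
Proof.
move=> [fR fI] [hR hI]; split.
  by apply: (eq_smooth_on (fun q => esym (ReD _ _))); exact: smooth_onD.
by apply: (eq_smooth_on (fun q => esym (ImD _ _))); exact: smooth_onD.
Qed.

Lemma smooth_onCM (f h : M -> R[i]) : smooth_onC A W f -> smooth_onC A W h ->
  smooth_onC A W (fun q => f q * h q).
Proof.
move=> [fR fI] [hR hI]; split.
  apply: (eq_smooth_on (fun q => esym (ReM _ _))).
  by apply: smooth_onB => //; exact: smooth_onM.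
apply: (eq_smooth_on (fun q => esym (ImM _ _))).
by apply: smooth_onD => //; exact: smooth_onM.
Qed.

Lemma smooth_onC_sum (J : finType) (f : J -> M -> R[i]) :
  (forall j, smooth_onC A W (f j)) -> smooth_onC A W (fun q => \sum_j f j q).
Proof.
move=> sf; rewrite (_ : (fun q => _) = \sum_j f j); last first.
  by apply/funext => q; rewrite fct_sumE.
elim/big_ind: _ => [|f1 f2 s1 s2|j _]; [exact: smooth_onC_cst| |exact: sf].
exact: smooth_onCD.
Qed.

Lemma smooth_mx_cst a b (C : 'M[R[i]]_(a, b)) : smooth_mx W (fun=> C).
Proof. by move=> i j; exact: smooth_onC_cst. Qed.

Lemma smooth_mxD a b (F G : M -> 'M[R[i]]_(a, b)) : smooth_mx W F -> smooth_mx W G ->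
  smooth_mx W (fun q => F q + G q).
Proof.
move=> sF sG i j; apply: (eq_smooth_onC (fun q => esym (mxE _ _ _ _))); exact: smooth_onCD.
Qed.

Lemma smooth_mxM a b c (F : M -> 'M[R[i]]_(a, b)) (G : M -> 'M[R[i]]_(b, c)) :
  smooth_mx W F -> smooth_mx W G -> smooth_mx W (fun q => F q *m G q).
Proof.
move=> sF sG i j; apply: (eq_smooth_onC (fun q => esym (mxE _ _ _ _))).
by apply: smooth_onC_sum => k; exact: smooth_onCM.
Qed.

Lemma smooth_mxZ a b (z : R[i]) (F : M -> 'M[R[i]]_(a, b)) : smooth_mx W F ->
  smooth_mx W (fun q => z *: F q).
Proof.
move=> sF i j; apply: (eq_smooth_onC (fun q => esym (mxE _ _ _ _))).
by apply: smooth_onCM => //; exact: smooth_onC_cst.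
Qed.

Lemma smooth_mx_real a b (C : 'M[R[i]]_(a, b)) f : smooth_on A W f ->
  smooth_mx W (fun q => (f q)%:C *: C).
Proof.
move=> sf i j; apply: (eq_smooth_onC (fun q => esym (mxE _ _ _ _))).
by apply: smooth_onCM; [split=> //; exact: smooth_on_cst|exact: smooth_onC_cst].
Qed.

Lemma smooth_mx_sum a b (J : finType) (F : J -> M -> 'M[R[i]]_(a, b)) :
  (forall k, smooth_mx W (F k)) -> smooth_mx W (fun q => \sum_k F k q).
Proof.
move=> sF i j; apply: (eq_smooth_onC (fun q => esym (summxE _ _ _ _ _))).
by apply: smooth_onC_sum => k; exact: sF.
Qed.

Variables (p : M) (v : tvec R M).
Hypotheses (Wp : W p) (vp : tangent A p v).

Let near_on f : smooth_on A W f -> smooth_near A p f.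
Proof. exact: smooth_on_near. Qed.

Lemma dcomplex_cst (z : R[i]) : dcomplex v (fun=> z) = 0.
Proof. by rewrite /dcomplex !(tangent_cst vp). Qed.

Lemma dcomplexD (f h : M -> R[i]) : smooth_onC A W f -> smooth_onC A W h ->
  dcomplex v (fun q => f q + h q) = dcomplex v f + dcomplex v h.
Proof.
move=> [fR fI] [hR hI]; rewrite /dcomplex.
have -> : (fun q => complex.Re (f q + h q)) =
    (fun q => complex.Re (f q) + complex.Re (h q)).
  by apply/funext => q; rewrite ReD.
have -> : (fun q => complex.Im (f q + h q)) =
    (fun q => complex.Im (f q) + complex.Im (h q)).
  by apply/funext => q; rewrite ImD.
by rewrite !(tangentD vp) //; exact: near_on.
Qed.

Lemma dcomplexM (f h : M -> R[i]) : smooth_onC A W f -> smooth_onC A W h ->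
  dcomplex v (fun q => f q * h q) = dcomplex v f * h p + f p * dcomplex v h.
Proof.
move=> [fR fI] [hR hI]; rewrite /dcomplex.
have -> : (fun q => complex.Re (f q * h q)) = (fun q =>
   complex.Re (f q) * complex.Re (h q) + - (complex.Im (f q) * complex.Im (h q))).
  by apply/funext => q; rewrite ReM.
have -> : (fun q => complex.Im (f q * h q)) = (fun q =>
   complex.Re (f q) * complex.Im (h q) + complex.Im (f q) * complex.Re (h q)).
  by apply/funext => q; rewrite ImM.
rewrite !(tangentD vp); try by apply: near_on; try apply: smooth_onN => //; exact: smooth_onM.
rewrite (tangentN vp); last by apply: near_on; exact: smooth_onM.
rewrite !(tangent_leibniz vp); try exact: near_on.
case: (f p) => fr fi; case: (h p) => hr hi /=.
by apply/eqP; rewrite eq_complex /=; apply/andP; split; apply/eqP; ring.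
Qed.

Lemma dcomplex_sum (J : finType) (f : J -> M -> R[i]) :
  (forall j, smooth_onC A W (f j)) ->
  dcomplex v (fun q => \sum_j f j q) = \sum_j dcomplex v (f j).
Proof.
move=> sf; rewrite (_ : (fun q => _) = \sum_j f j); last first.
  by apply/funext => q; rewrite fct_sumE.
suff [] : smooth_onC A W (\sum_j f j) /\
  dcomplex v (\sum_j f j) = \sum_j dcomplex v (f j) by [].
elim/big_ind2: _ => [|f1 d1 f2 d2 [s1 <-] [s2 <-]|j _ //].
  by split; [exact: smooth_onC_cst|exact: dcomplex_cst].
by split; [exact: smooth_onCD|rewrite -dcomplexD].
Qed.

Lemma dmatrix_cst a b (C : 'M[R[i]]_(a, b)) : dmatrix v (fun=> C) = 0.
Proof. by apply/matrixP => i j; rewrite dmatrixE mxE dcomplex_cst. Qed.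

Lemma dmatrixD a b (F G : M -> 'M[R[i]]_(a, b)) : smooth_mx W F -> smooth_mx W G ->
  dmatrix v (fun q => F q + G q) = dmatrix v F + dmatrix v G.
Proof.
move=> sF sG; apply/matrixP => i j; rewrite [RHS]mxE !dmatrixE -dcomplexD //.
by congr dcomplex; apply/funext => q; rewrite mxE.
Qed.

Lemma dmatrixM a b c (F : M -> 'M[R[i]]_(a, b)) (G : M -> 'M[R[i]]_(b, c)) :
  smooth_mx W F -> smooth_mx W G ->
  dmatrix v (fun q => F q *m G q) = dmatrix v F *m G p + F p *m dmatrix v G.
Proof.
move=> sF sG; apply/matrixP => i j; rewrite [RHS]mxE [X in X + _]mxE [X in _ + X]mxE -big_split dmatrixE /=.
rewrite (_ : (fun q => _) = (fun q => \sum_k F q i k * G q k j)); last first.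
  by apply/funext => q; rewrite mxE.
rewrite dcomplex_sum; last by move=> k; exact: smooth_onCM.
by apply: eq_bigr => k _; rewrite dcomplexM // !dmatrixE.
Qed.

Lemma dmatrixZ a b (z : R[i]) (F : M -> 'M[R[i]]_(a, b)) : smooth_mx W F ->
  dmatrix v (fun q => z *: F q) = z *: dmatrix v F.
Proof.
move=> sF; apply/matrixP => i j; rewrite [RHS]mxE !dmatrixE.
rewrite (_ : (fun q => _) = (fun q => z * F q i j)); last first.
  by apply/funext => q; rewrite mxE.
rewrite dcomplexM //; last exact: smooth_onC_cst.
by rewrite dcomplex_cst mul0r add0r.
Qed.

Lemma dmatrix_real a b (C : 'M[R[i]]_(a, b)) f : smooth_on A W f ->
  dmatrix v (fun q => (f q)%:C *: C) = (v f)%:C *: C.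
Proof.
move=> sf; apply/matrixP => i j; rewrite [RHS]mxE dmatrixE.
rewrite (_ : (fun q => _) = (fun q => (f q)%:C * C i j)); last first.
  by apply/funext => q; rewrite mxE.
rewrite dcomplexM; [|by split=> //; exact: smooth_on_cst|exact: smooth_onC_cst].
by rewrite dcomplex_cst mulr0 addr0 /dcomplex /= (tangent_cst vp).
Qed.

Lemma dmatrix_sum a b (J : finType) (F : J -> M -> 'M[R[i]]_(a, b)) :
  (forall k, smooth_mx W (F k)) ->
  dmatrix v (fun q => \sum_k F k q) = \sum_k dmatrix v (F k).
Proof.
move=> sF; apply/matrixP => i j; rewrite dmatrixE summxE.
rewrite (_ : (fun q => _) = (fun q => \sum_k F k q i j)); last first.
  by apply/funext => q; rewrite summxE.
rewrite dcomplex_sum; last by move=> k; exact: sF.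
by apply: eq_bigr => k _; rewrite dmatrixE.
Qed.

Lemma dmatrix_eq a b (F G : M -> 'M[R[i]]_(a, b)) :
  (forall q, W q -> F q = G q) -> dmatrix v F = dmatrix v G.
Proof.
move=> FG; apply/matrixP => i j; rewrite !dmatrixE /dcomplex.
by congr (_ +i* _); apply: (tangent_eq_on vp oW Wp) => q Wq; rewrite FG.
Qed.

End Matrix.

End Manifold.

(** * Vector fields and the frame components of curvature and torsion *)

Section TangentVectors.
Context {R : realType} {n : nat} {M : topologicalType}.
Variable (A : set (chart R n M)).
Hypothesis hM : smooth_manifold A.
Implicit Types (W : set M) (f h : M -> R) (p : M) (v w : tvec R M).

Lemma tangent_comb p a v w : tangent A p v -> tangent A p w ->
  tangent A p (tadd (tscale a v) w).
Proof.
move=> tv tw; split; rewrite /tadd /tscale.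
- move=> b f h sf sh; rewrite !(tangent_linear tv, tangent_linear tw) //; ring.
- move=> f h sf sh; rewrite !(tangent_leibniz tv, tangent_leibniz tw) //; ring.
- by move=> f h fh; rewrite (tangent_germ tv fh) (tangent_germ tw fh).
- by move=> f nf; rewrite (tangent_junk tv nf) (tangent_junk tw nf) mulr0 addr0.
Qed.

Lemma tangent_add p v w : tangent A p v -> tangent A p w -> tangent A p (tadd v w).
Proof.
move=> tv tw; rewrite (_ : tadd v w = tadd (tscale 1 v) w); first exact: tangent_comb.
by apply/funext => f; rewrite /tadd /tscale mul1r.
Qed.

Lemma tangent_zero p : tangent A p (@tzero R M).
Proof. by split; rewrite /tzero => *; rewrite ?mulr0 ?mul0r ?addr0. Qed.

Lemma tsubE v w : tsub v w = tadd (tscale (-1) w) v.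
Proof. by apply/funext => f; rewrite /tsub /tadd addrC. Qed.

Lemma tangent_sub p v w : tangent A p v -> tangent A p w -> tangent A p (tsub v w).
Proof. by move=> tv tw; rewrite tsubE; exact: tangent_comb. Qed.

Lemma tangent_sum p (c : 'I_n -> R) (b : 'I_n -> tvec R M) :
  (forall i, tangent A p (b i)) -> tangent A p (fun f => \sum_i c i * b i f).
Proof.
move=> tb; elim: (index_enum _) => [|i s ts].
  rewrite (_ : (fun f => _) = @tzero R M); first exact: tangent_zero.
  by apply/funext => f; rewrite big_nil.
rewrite (_ : (fun f => _) =
    tadd (tscale (c i) (b i)) (fun f => \sum_(i <- s) c i * b i f)).
  exact: tangent_comb.
by apply/funext => f; rewrite big_cons.
Qed.

(** Linearity on the derivations at p only: elements of [tvec] which are not tangent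
    vectors are ignored. *)
Definition tlinear p (L : tvec R M -> R) := forall a v w,
  tangent A p v -> tangent A p w -> L (tadd (tscale a v) w) = a * L v + L w.

Section Tlinear.
Variables (p : M) (L : tvec R M -> R).
Hypothesis LL : tlinear p L.

Lemma tlinear0 : L (@tzero R M) = 0.
Proof.
have := LL 1 (tangent_zero p) (tangent_zero p); rewrite mul1r.
rewrite (_ : tadd _ _ = @tzero R M); last first.
  by apply/funext => f; rewrite /tadd /tscale /tzero mulr0 addr0.
by move/eqP; rewrite -subr_eq0 opprD addrA subrr sub0r oppr_eq0 => /eqP.
Qed.

Lemma tlinearB v w : tangent A p v -> tangent A p w -> L (tsub v w) = L v - L w.
Proof. by move=> tv tw; rewrite tsubE LL // mulN1r addrC. Qed.

Lemma tlinearD v w : tangent A p v -> tangent A p w -> L (tadd v w) = L v + L w.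
Proof.
move=> tv tw; rewrite -[L v]mul1r -LL //; congr L.
by apply/funext => f; rewrite /tadd /tscale mul1r.
Qed.

Lemma tlinear_sum (c : 'I_n -> R) (b : 'I_n -> tvec R M) :
  (forall i, tangent A p (b i)) ->
  L (fun f => \sum_i c i * b i f) = \sum_i c i * L (b i).
Proof.
move=> tb.
suff H (s : seq 'I_n) : tangent A p (fun f => \sum_(i <- s) c i * b i f) /\
   L (fun f => \sum_(i <- s) c i * b i f) = \sum_(i <- s) c i * L (b i).
  exact: (H _).2.
elim: s => [|i s [ts Ls]].
  rewrite (_ : (fun f => _) = @tzero R M); last first.
    by apply/funext => f; rewrite big_nil.
  by split; [exact: tangent_zero|rewrite tlinear0 big_nil].
rewrite (_ : (fun f => _) =
    tadd (tscale (c i) (b i)) (fun f => \sum_(i <- s) c i * b i f)); last first.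
  by apply/funext => f; rewrite big_cons.
by split; [exact: tangent_comb|rewrite LL // Ls big_cons].
Qed.

End Tlinear.

Lemma smooth_vfieldB W (X Y : vfield R M) : open W ->
  smooth_vfield A W X -> smooth_vfield A W Y ->
  smooth_vfield A W (fun q => tsub (X q) (Y q)).
Proof.
move=> oW [tX sX] [tY sY]; split=> [q Wq|W' f oW' WW' sf].
  by apply: tangent_sub; [exact: tX|exact: tY].
apply: (@smooth_on_eq _ _ _ _ hM _ (fun q => X q f - Y q f)) => //.
  by move=> q _; rewrite /tsub /tadd /tscale mulN1r.
by apply: (smooth_onB hM) => //; [exact: sX|exact: sY].
Qed.

Lemma smooth_vfield_eq W (X Y : vfield R M) : open W ->
  (forall q, W q -> X q = Y q) -> smooth_vfield A W X -> smooth_vfield A W Y.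
Proof.
move=> oW XY [tX sX]; split=> [q Wq|W' f oW' WW' sf].
  by rewrite -XY //; exact: tX.
apply: (@smooth_on_eq _ _ _ _ hM _ (fun q => X q f)) => //.
  by move=> q W'q; rewrite XY //; exact: WW'.
exact: sX.
Qed.

Lemma smooth_vfieldN W (X : vfield R M) : open W -> smooth_vfield A W X ->
  smooth_vfield A W (fun q => tscale (-1) (X q)).
Proof.
move=> oW sX.
have s0 : smooth_vfield A W (fun=> @tzero R M).
  by split=> [q _|W' f _ _ _]; [exact: tangent_zero|exact: smooth_on_cst].
apply: smooth_vfield_eq (smooth_vfieldB oW s0 sX) => // q _.
by apply/funext => f; rewrite /tsub /tadd /tzero add0r.
Qed.

Lemma lie_bracketE p (X Y : vfield R M) f : smooth_near A p f ->
  lie_bracket A X Y p f = X p (fun q => Y q f) - Y p (fun q => X q f).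
Proof. by move=> sf; rewrite /lie_bracket asboolT. Qed.

Lemma lie_bracket_junk p (X Y : vfield R M) f : ~ smooth_near A p f ->
  lie_bracket A X Y p f = 0.
Proof. by move=> sf; rewrite /lie_bracket asboolF. Qed.

(** The bracket is a commutator of operators, but only on functions which are smooth
    near p; on all others every bracket vanishes by convention. *)
Lemma jacobi W p (X Y Z : vfield R M) f : open W -> W p ->
  smooth_vfield A W X -> smooth_vfield A W Y -> smooth_vfield A W Z ->
  lie_bracket A X (lie_bracket A Y Z) p f + lie_bracket A Y (lie_bracket A Z X) p f
  + lie_bracket A Z (lie_bracket A X Y) p f = 0.
Proof.
move=> oW Wp sX sY sZ.
have [|nf] := pselect (smooth_near A p f); last by rewrite !lie_bracket_junk // !addr0.
move=> [V [oV Vp sf]].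
have oVW : open (V `&` W) by exact: openI.
have sfV : smooth_on A (V `&` W) f by apply: smooth_on_subset sf => q [].
have sub B : smooth_vfield A W B -> smooth_vfield A (V `&` W) B.
  move=> [tB sB]; split=> [q [_ Wq]|W' h oW' W'W sh]; first exact: tB.
  by apply: sB => // q /W'W [].
have key B C D : smooth_vfield A W B -> smooth_vfield A W C -> smooth_vfield A W D ->
   lie_bracket A B (lie_bracket A C D) p f =
   B p (fun q => C q (fun r => D r f)) - B p (fun q => D q (fun r => C r f))
   - C p (fun q => D q (fun r => B r f)) + D p (fun q => C q (fun r => B r f)).
  move=> /sub sB /sub sC /sub sD.
  have near h : smooth_on A (V `&` W) h -> smooth_near A p h by exists (V `&` W).
  have s1 B' : smooth_vfield A (V `&` W) B' -> smooth_on A (V `&` W) (fun q => B' q f).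
    by move=> sB'; apply: sB'.2.
  have s2 B' C' : smooth_vfield A (V `&` W) B' -> smooth_vfield A (V `&` W) C' ->
      smooth_on A (V `&` W) (fun q => B' q (fun r => C' r f)).
    by move=> sB' sC'; apply: sB'.2 => //; exact: s1.
  have tB : tangent A p (B p) by apply: sB.1.
  rewrite lie_bracketE; last exact: near.
  rewrite lie_bracketE; last by apply: near; exact: s1.
  have -> : B p (fun q => lie_bracket A C D q f) =
      B p (fun q => C q (fun r => D r f) + - D q (fun r => C r f)).
    apply: (tangent_eq_on tB oVW) => // q VWq.
    by rewrite lie_bracketE //; exists (V `&` W).
  rewrite (tangentD tB); [|by apply: near; exact: (s2 C D)|]; last first.
    by apply: near; apply: (smooth_onN hM oVW); exact: (s2 D C).
  rewrite (tangentN tB); last by apply: near; exact: (s2 D C).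
  ring.
rewrite !key //; ring.
Qed.

End TangentVectors.

Section Frame.
Context {R : realType} {n : nat} {M : topologicalType}.
Variable (A : set (chart R n M)).
Hypothesis hM : smooth_manifold A.
Variables (g : M -> tvec R M -> tvec R M -> R).
Hypothesis hg : riemannian_metric A g.
Variables (nabla : M -> tvec R M -> vfield R M -> tvec R M).
Hypothesis hnabla : levi_civita A g nabla.
Variables (U : set M) (e : 'I_n -> vfield R M).
Hypothesis he : orthonormal_frame A g U e.

Let oU : open U. Proof. exact: frame_open he. Qed.
Let sme i : smooth_vfield A U (e i). Proof. exact: frame_smooth he i. Qed.
Let tane p i : U p -> tangent A p (e i p). Proof. by move=> Up; exact: (sme i).1. Qed.

Definition frame_conn i j : vfield R M := fun q => nabla q (e i q) (e j).
(** The connection coefficients of the frame. *)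
Definition omega i j k : M -> R := fun q => g q (frame_conn i j q) (e k q).

Let smconn i j : smooth_vfield A U (frame_conn i j).
Proof. exact: (lc_smooth hnabla oU (sme i) (sme j)). Qed.
Let tanconn p i j : U p -> tangent A p (frame_conn i j p).
Proof. by move=> Up; exact: (smconn i j).1. Qed.

Lemma omega_smooth i j k : smooth_on A U (omega i j k).
Proof. exact: (metric_smooth hg oU (smconn i j) (sme k)). Qed.

(** Any expression linear in a tangent vector is determined by its values on the
    frame; this turns all tensors into components. *)
Lemma frame_expand p (L : tvec R M -> R) v : U p -> tlinear A p L -> tangent A p v ->
  L v = \sum_i g p v (e i p) * L (e i p).
Proof.
move=> Up LL tv; have [c ->] := frame_span he Up tv.
rewrite (tlinear_sum LL); last by move=> i; exact: tane.
apply: eq_bigr => i _; congr (_ * _).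
have Lg : tlinear A p (fun u => g p u (e i p)).
  by move=> a u w tu tw; apply: (metric_linear hg) => //; exact: tane.
rewrite (tlinear_sum Lg); last by move=> j; exact: tane.
rewrite (bigD1 i) //= (frame_orthonormal he) // eqxx mulr1 big1 ?addr0 // => j ji.
by rewrite (frame_orthonormal he) // (negPf ji) mulr0.
Qed.

Lemma tlinear_metric p w : tangent A p w -> tlinear A p (fun v => g p v w).
Proof. by move=> tw a u v tu tv; apply: (metric_linear hg). Qed.

Lemma tlinear_eval p f : tlinear A p (fun v => v f).
Proof. by []. Qed.

Lemma tlinear_nabla_eval p Y f : smooth_vfield_near A p Y ->
  tlinear A p (fun v => nabla p v Y f).
Proof. by move=> sY a u v tu tv; rewrite (lc_linear hnabla). Qed.

Lemma tangent_nabla_frame p v k : U p -> tangent A p v ->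
  tangent A p (nabla p v (e k)).
Proof.
move=> Up tv.
have -> : nabla p v (e k) = fun f => \sum_m g p v (e m p) * frame_conn m k p f.
  apply/funext => f; rewrite (frame_expand (L := fun v => nabla p v (e k) f) Up _ tv) //.
  by apply: tlinear_nabla_eval; exists U.
by apply: tangent_sum => m; exact: tanconn.
Qed.

Lemma tlinear_nabla_metric p k w : U p -> tangent A p w ->
  tlinear A p (fun v => g p (nabla p v (e k)) w).
Proof.
move=> Up tw a u v tu tv; rewrite (lc_linear hnabla) //; last by exists U.
by rewrite (metric_linear hg) //; exact: tangent_nabla_frame.
Qed.

(** The derivative of the constant function g(e_j, e_k). *)
Lemma omega_antisym p i j k : U p -> omega i j k p = - omega i k j p.
Proof.
move=> Up; have tei := tane i Up.
have ne l : smooth_vfield_near A p (e l) by exists U.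
have := lc_metric hnabla tei (ne j) (ne k).
rewrite (tangent_eq_on tei oU Up (h := fun=> (j == k)%:R)); last first.
  by move=> q Uq; rewrite (frame_orthonormal he).
rewrite (tangent_cst tei) => /esym /eqP; rewrite addr_eq0 => /eqP E.
rewrite /omega /frame_conn E (Defs.metric_sym hg) //; [exact: tane|exact: tanconn].
Qed.

Lemma lie_frame p i j : U p ->
  lie_bracket A (e i) (e j) p = tsub (frame_conn i j p) (frame_conn j i p).
Proof.
by move=> Up; rewrite -(lc_torsion_free hnabla) //; exists U.
Qed.

Lemma tangent_lie_frame p i j : U p -> tangent A p (lie_bracket A (e i) (e j) p).
Proof. by move=> Up; rewrite lie_frame //; apply: tangent_sub; exact: tanconn. Qed.

(** The structure coefficients of the frame: [e_i, e_j] = sum_k c_ijk e_k, by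
    torsion-freeness. *)
Definition struct_coef i j k p := omega i j k p - omega j i k p.

Lemma lie_frame_expand p (L : tvec R M -> R) i j : U p -> tlinear A p L ->
  L (lie_bracket A (e i) (e j) p) = \sum_m struct_coef i j m p * L (e m p).
Proof.
move=> Up LL; rewrite (frame_expand Up LL); last exact: tangent_lie_frame.
apply: eq_bigr => m _; congr (_ * _); rewrite lie_frame //.
by rewrite (tlinearB (tlinear_metric (tane m Up))) //; exact: tanconn.
Qed.

Lemma frame_derivative_comm p f i j : U p -> smooth_near A p f ->
  e i p (fun q => e j q f) - e j p (fun q => e i q f)
  = \sum_m struct_coef i j m p * e m p f.
Proof.
move=> Up sf; rewrite -(lie_frame_expand i j Up (@tlinear_eval p f)).
by rewrite lie_bracketE.
Qed.

Definition riem i j k l p := g p (curvature A nabla (e i) (e j) (e k) p) (e l p).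

(** Cartan's structure equation for the curvature in the frame. *)
Lemma riemE p i j k l : U p -> riem i j k l p =
  e i p (omega j k l) - e j p (omega i k l)
  - \sum_m omega j k m p * omega i l m p + \sum_m omega i k m p * omega j l m p
  - \sum_m struct_coef i j m p * omega m k l p.
Proof.
move=> Up.
have ne m : smooth_vfield_near A p (e m) by exists U.
have nc a b : smooth_vfield_near A p (frame_conn a b) by exists U.
have Lg := tlinear_metric (tane l Up).
have tc2 a b c : tangent A p (nabla p (e a p) (frame_conn b c)).
  by apply: (lc_smooth hnabla oU (sme a) (smconn b c)).1.
have sl : smooth_vfield A U (lie_bracket A (e i) (e j)).
  apply: smooth_vfield_eq (smooth_vfieldB hM oU (smconn i j) (smconn j i)) => //.
  by move=> q Uq; rewrite lie_frame.
have tl : tangent A p (nabla p (lie_bracket A (e i) (e j) p) (e k)).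
  by apply: (lc_smooth hnabla oU sl (sme k)).1.
have d2 a b : g p (nabla p (e a p) (frame_conn b k)) (e l p) =
    e a p (omega b k l) - \sum_m omega b k m p * omega a l m p.
  (* Metric compatibility gives the components of nabla_a (nabla_b e_k) without
     expanding nabla_b e_k in the frame. *)
  have -> : e a p (omega b k l) = g p (nabla p (e a p) (frame_conn b k)) (e l p)
      + g p (frame_conn b k p) (frame_conn a l p).
    exact: (lc_metric hnabla (tane a Up) (nc b k) (ne l)).
  rewrite (frame_expand Up (tlinear_metric (tanconn a l Up))); last exact: tanconn.
  rewrite -addrA -sumrB big1 ?addr0 // => m _.
  rewrite -[omega a l m p]/(g p (frame_conn a l p) (e m p)).
  rewrite (Defs.metric_sym hg (tanconn a l Up) (tane m Up)).
  by rewrite -[g p (frame_conn b k p) _]/(omega b k m p) subrr.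
have Lk : tlinear A p (fun v => g p (nabla p v (e k)) (e l p)).
  by apply: tlinear_nabla_metric => //; exact: tane.
have -> : riem i j k l p = g p (nabla p (e i p) (frame_conn j k)) (e l p)
   - g p (nabla p (e j p) (frame_conn i k)) (e l p)
   - g p (nabla p (lie_bracket A (e i) (e j) p) (e k)) (e l p).
  rewrite /riem /curvature (tlinearB Lg) //; last by apply: tangent_sub; exact: tc2.
  by rewrite (tlinearB Lg) //; exact: tc2.
rewrite !d2 (lie_frame_expand i j Up Lk).
rewrite -[\sum_m struct_coef i j m p * _]/(\sum_m struct_coef i j m p * omega m k l p).
ring.
Qed.

Lemma riem_antisym12 p i j k l : U p -> riem i j k l p = - riem j i k l p.
Proof.
move=> Up; rewrite !riemE //.
have -> : \sum_m struct_coef j i m p * omega m k l p = - \sum_m struct_coef i j m p * omega m k l p.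
  by rewrite -sumrN; apply: eq_bigr => m _; rewrite /struct_coef; ring.
rewrite [X in _ = - (_ - X + _ - _)](eq_bigr (fun m => omega i k m p * omega j l m p)) //.
ring.
Qed.

Lemma riem_antisym34 p i j k l : U p -> riem i j k l p = - riem i j l k p.
Proof.
move=> Up; rewrite !riemE //.
have d a b : e a p (omega b k l) = - e a p (omega b l k).
  rewrite -(tangentN (tane a Up)); last by exists U; split=> //; exact: omega_smooth.
  apply: (tangent_eq_on (tane a Up) oU Up) => q Uq; exact: omega_antisym.
rewrite !d.
have -> : \sum_m struct_coef i j m p * omega m k l p = - \sum_m struct_coef i j m p * omega m l k p.
  by rewrite -sumrN; apply: eq_bigr => m _; rewrite (omega_antisym m k) //; ring.
have s a b : \sum_m omega a k m p * omega b l m p = \sum_m omega b l m p * omega a k m p.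
  by apply: eq_bigr => m _; rewrite mulrC.
rewrite (s j i) (s i j); ring.
Qed.

(** Since nabla is torsion free, the cyclic sum of the curvature is the cyclic sum of
    the double brackets [e_i, [e_j, e_k]], which is zero by the Jacobi identity. *)
Lemma riem_bianchi p i j k l : U p ->
  riem i j k l p + riem j k i l p + riem k i j l p = 0.
Proof.
move=> Up.
have nc a b : smooth_vfield_near A p (frame_conn a b) by exists U.
have brk a b q : U q -> lie_bracket A (e a) (e b) q = tsub (frame_conn a b q) (frame_conn b a q).
  exact: lie_frame.
have sbrk a b : smooth_vfield A U (lie_bracket A (e a) (e b)).
  apply: (smooth_vfield_eq hM oU _ (smooth_vfieldB hM oU (smconn a b) (smconn b a))).
  by move=> q Uq; rewrite brk.
have tc2 a b c : tangent A p (nabla p (e a p) (frame_conn b c)).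
  by apply: (lc_smooth hnabla oU (sme a) (smconn b c)).1.
have tl a b c : tangent A p (nabla p (lie_bracket A (e a) (e b) p) (e c)).
  by apply: tangent_nabla_frame => //; exact: (sbrk a b).1.
have tcurv a b c : tangent A p (curvature A nabla (e a) (e b) (e c) p).
  by apply: tangent_sub => //; apply: tangent_sub; exact: tc2.
have Lg := tlinear_metric (tane l Up).
have key a b c f : nabla p (e a p) (frame_conn b c) f - nabla p (e a p) (frame_conn c b) f
    - nabla p (lie_bracket A (e b) (e c) p) (e a) f
    = lie_bracket A (e a) (lie_bracket A (e b) (e c)) p f.
  have sa : smooth_vfield_near A p (e a) by exists U.
  have sbc : smooth_vfield_near A p (lie_bracket A (e b) (e c)) by exists U.
  rewrite -(lc_torsion_free hnabla sa sbc) /tsub /tadd /tscale mulN1r.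
  congr (_ - _).
  have snc : smooth_vfield A U (fun q => tscale (-1) (frame_conn c b q)).
    exact: (smooth_vfieldN hM oU (smconn c b)).
  have -> : nabla p (e a p) (lie_bracket A (e b) (e c)) =
     nabla p (e a p) (fun q => tadd (frame_conn b c q) (tscale (-1) (frame_conn c b q))).
    apply: (lc_germ hnabla) => //; [exact: tane| |].
      exists U; split=> //; exact: (smooth_vfieldB hM oU (smconn b c) (smconn c b)).
    by apply: filterS (open_nbhs_nbhs (conj oU Up)) => q Uq; rewrite brk.
  rewrite (lc_add hnabla) //; [|exact: tane|by exists U].
  rewrite (lc_leibniz hnabla (f := fun=> -1)) //; [|exact: tane|].
    by rewrite (tangent_cst (tane a Up)) /tadd /tscale mul0r add0r mulN1r.
  by exists setT; split=> //; [exact: openT|exact: smooth_on_cst].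
rewrite /riem -(tlinearD Lg) // -(tlinearD Lg) //; last exact: tangent_add.
rewrite (_ : tadd _ _ = @tzero R M); first exact: (tlinear0 Lg).
apply/funext => f.
rewrite /tzero -(jacobi hM f oU Up (sme i) (sme j) (sme k)) -!key.
rewrite /curvature /tsub /tadd /tscale; ring.
Qed.

Section ThreeForm.
Variable T : M -> tvec R M -> tvec R M -> tvec R M -> R.
Hypothesis hT : three_form A T.

Definition torsion_comp i j k : M -> R := fun q => T q (e i q) (e j q) (e k q).

Lemma torsion_comp_smooth i j k : smooth_on A U (torsion_comp i j k).
Proof. exact: (form_smooth hT oU (sme i) (sme j) (sme k)). Qed.

Lemma torsion_comp_antisym12 p i j k : U p -> torsion_comp i j k p = - torsion_comp j i k p.
Proof. by move=> Up; apply: (form_antisym12 hT); exact: tane. Qed.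

Lemma torsion_comp_antisym23 p i j k : U p -> torsion_comp i j k p = - torsion_comp i k j p.
Proof. by move=> Up; apply: (form_antisym23 hT); exact: tane. Qed.

(** The component (nabla_(e_i) T)(e_j, e_k, e_l). *)
Definition nablaT i j k l p := e i p (torsion_comp j k l) -
  \sum_m (omega i j m p * torsion_comp m k l p + omega i k m p * torsion_comp j m l p
          + omega i l m p * torsion_comp j k m p).

Lemma nablaT_antisym12 p i j k l : U p -> nablaT i j k l p = - nablaT i k j l p.
Proof.
move=> Up; rewrite /nablaT.
have -> : e i p (torsion_comp j k l) = - e i p (torsion_comp k j l).
  rewrite -(tangentN (tane i Up)); last by exists U; split=> //; exact: torsion_comp_smooth.
  apply: (tangent_eq_on (tane i Up) oU Up) => q Uq; exact: torsion_comp_antisym12.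
rewrite opprB addrC -sumrN; congr (_ - _).
apply: eq_bigr => m _; rewrite (torsion_comp_antisym12 m k) // (torsion_comp_antisym12 j m) //.
rewrite (torsion_comp_antisym12 j k) //; ring.
Qed.

Lemma nablaT_antisym23 p i j k l : U p -> nablaT i j k l p = - nablaT i j l k p.
Proof.
move=> Up; rewrite /nablaT.
have -> : e i p (torsion_comp j k l) = - e i p (torsion_comp j l k).
  rewrite -(tangentN (tane i Up)); last by exists U; split=> //; exact: torsion_comp_smooth.
  apply: (tangent_eq_on (tane i Up) oU Up) => q Uq; exact: torsion_comp_antisym23.
rewrite opprB addrC -sumrN; congr (_ - _).
apply: eq_bigr => m _; rewrite (torsion_comp_antisym23 m k) // (torsion_comp_antisym23 j m) //.
rewrite (torsion_comp_antisym23 j k) //; ring.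
Qed.

(** The brackets in dT become differences of connection coefficients; these are the
    correction terms of the four covariant derivatives. *)
Lemma ext_deriv_frame p i j k l : U p ->
  ext_deriv A T (e i) (e j) (e k) (e l) p =
  nablaT i j k l p - nablaT j i k l p + nablaT k i j l p - nablaT l i j k p.
Proof.
move=> Up.
have LT b c : tlinear A p (fun v => T p v (e b p) (e c p)).
  by move=> a u v tu tv; apply: (form_linear hT) => //; exact: tane.
rewrite /ext_deriv.
rewrite !(fun a b c d => lie_frame_expand a b Up (LT c d)) /nablaT.
rewrite -!/(torsion_comp _ _ _) /=.
transitivity (e i p (torsion_comp j k l) - e j p (torsion_comp i k l) + e k p (torsion_comp i j l)
  - e l p (torsion_comp i j k) + \sum_m (struct_coef i k m p * torsion_comp m j l p
  + struct_coef j l m p * torsion_comp m i k p - struct_coef i j m p * torsion_comp m k l p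
  - struct_coef i l m p * torsion_comp m j k p - struct_coef j k m p * torsion_comp m i l p
  - struct_coef k l m p * torsion_comp m i j p)).
  rewrite !sumrB big_split /=; ring.
(* Both sides as one sum over m, compared summand by summand. *)
transitivity (e i p (torsion_comp j k l) - e j p (torsion_comp i k l) + e k p (torsion_comp i j l)
  - e l p (torsion_comp i j k) + \sum_m (
    - (omega i j m p * torsion_comp m k l p + omega i k m p * torsion_comp j m l p
       + omega i l m p * torsion_comp j k m p)
    + (omega j i m p * torsion_comp m k l p + omega j k m p * torsion_comp i m l p
       + omega j l m p * torsion_comp i k m p)
    - (omega k i m p * torsion_comp m j l p + omega k j m p * torsion_comp i m l p
       + omega k l m p * torsion_comp i j m p)
    + (omega l i m p * torsion_comp m j k p + omega l j m p * torsion_comp i m k p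
       + omega l k m p * torsion_comp i j m p))).
  congr (_ + _); apply: eq_bigr => m _; rewrite /struct_coef.
  have t2 a b : torsion_comp a m b p = - torsion_comp m a b p by rewrite torsion_comp_antisym12.
  have t3 a b : torsion_comp a b m p = torsion_comp m a b p.
    by rewrite torsion_comp_antisym23 // torsion_comp_antisym12 // opprK.
  rewrite !t2 !t3; ring.
rewrite big_split sumrB big_split sumrN /=; ring.
Qed.

Lemma T0_squared_frame p : U p -> T0_squared g T e p =
  6^-1 * \sum_i \sum_j \sum_k torsion_comp i j k p ^+ 2.
Proof.
move=> Up; rewrite /T0_squared; congr (_ * _).
apply: eq_bigr => i _; apply: eq_bigr => j _.
set w := fun f => _.
have tw : tangent A p w by apply: tangent_sum => k; exact: tane.
rewrite (tlinear_sum (tlinear_metric tw)); last by move=> k; exact: tane.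
apply: eq_bigr => k _; rewrite expr2; congr (_ * _).
rewrite (Defs.metric_sym hg (tane k Up) tw).
rewrite (tlinear_sum (tlinear_metric (tane k Up))); last by move=> m; exact: tane.
rewrite (bigD1 k) //= (frame_orthonormal he) // eqxx mulr1 big1 ?addr0 // => m mk.
by rewrite (frame_orthonormal he) // (negPf mk) mulr0.
Qed.

End ThreeForm.

End Frame.

(** * The spin connection *)

Section SpinConnection.
Context {R : realType} {n : nat} {M : topologicalType}.
Variable (A : set (chart R n M)).
Hypothesis hM : smooth_manifold A.
Variables (g : M -> tvec R M -> tvec R M -> R).
Hypothesis hg : riemannian_metric A g.
Variables (nabla : M -> tvec R M -> vfield R M -> tvec R M).
Hypothesis hnabla : levi_civita A g nabla.
Variables (U : set M) (e : 'I_n -> vfield R M).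
Hypothesis he : orthonormal_frame A g U e.
Variable T : M -> tvec R M -> tvec R M -> tvec R M -> R.
Hypothesis hT : three_form A T.
Variable gam : 'I_n -> 'M[R[i]]_(spin_dim n).
Hypothesis hgam : clifford_rep gam.

Local Notation om := (omega g nabla e).
Local Notation tc := (torsion_comp e T).
Local Notation nT := (nablaT g nabla e T).

Let oU : open U. Proof. exact: frame_open he. Qed.
Let tane p i : U p -> tangent A p (e i p).
Proof. by move=> Up; exact: (frame_smooth he i).1. Qed.

Lemma smooth_cl_two (w : 'I_n -> 'I_n -> M -> R) :
  (forall i j, smooth_on A U (w i j)) ->
  smooth_mx A U (fun q => cl_two gam (fun i j => (w i j q)%:C)).
Proof.
move=> sw; under eq_fun do rewrite cl_twoE.
apply: (smooth_mxZ hM oU); apply: (smooth_mx_sum hM oU) => i.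
apply: (smooth_mxM hM oU); first exact: smooth_mx_cst.
under eq_fun do rewrite cl_vecE.
by apply: (smooth_mx_sum hM oU) => j; exact: (smooth_mx_real hM oU).
Qed.

Lemma dmatrix_cl_two p v (w : 'I_n -> 'I_n -> M -> R) : U p -> tangent A p v ->
  (forall i j, smooth_on A U (w i j)) ->
  dmatrix v (fun q => cl_two gam (fun i j => (w i j q)%:C))
  = cl_two gam (fun i j => (v (w i j))%:C).
Proof.
move=> Up vp sw; rewrite cl_twoE.
under [X in dmatrix v X]eq_fun do rewrite cl_twoE.
have sv i : smooth_mx A U (fun q => cl_vec gam (fun j => (w i j q)%:C)).
  under eq_fun do rewrite cl_vecE.
  by apply: (smooth_mx_sum hM oU) => j; exact: (smooth_mx_real hM oU).
have sp i : smooth_mx A U (fun q => gam i *m cl_vec gam (fun j => (w i j q)%:C)).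
  by apply: (smooth_mxM hM oU) => //; exact: smooth_mx_cst.
rewrite (dmatrixZ hM oU Up vp); last exact: (smooth_mx_sum hM oU).
rewrite (dmatrix_sum hM oU Up vp sp); congr (_ *: _); apply: eq_bigr => i _.
rewrite (dmatrixM hM oU Up vp) //; last exact: smooth_mx_cst.
rewrite (dmatrix_cst vp) mul0mx add0r; congr (_ *m _); rewrite cl_vecE.
under [X in dmatrix v X]eq_fun do rewrite cl_vecE.
rewrite (dmatrix_sum hM oU Up vp); last by move=> j; exact: (smooth_mx_real hM oU).
by apply: eq_bigr => j _; rewrite (dmatrix_real hM oU Up vp).
Qed.

Lemma smooth_cl_three (w : 'I_n -> 'I_n -> 'I_n -> M -> R) :
  (forall i j k, smooth_on A U (w i j k)) ->
  smooth_mx A U (fun q => cl_three gam (fun i j k => (w i j k q)%:C)).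
Proof.
move=> sw; under eq_fun do rewrite cl_threeE.
apply: (smooth_mxZ hM oU); apply: (smooth_mx_sum hM oU) => i.
by apply: (smooth_mxM hM oU); [exact: smooth_mx_cst|exact: smooth_cl_two].
Qed.

Lemma dmatrix_cl_three p v (w : 'I_n -> 'I_n -> 'I_n -> M -> R) : U p ->
  tangent A p v -> (forall i j k, smooth_on A U (w i j k)) ->
  dmatrix v (fun q => cl_three gam (fun i j k => (w i j k q)%:C))
  = cl_three gam (fun i j k => (v (w i j k))%:C).
Proof.
move=> Up vp sw; rewrite cl_threeE.
under [X in dmatrix v X]eq_fun do rewrite cl_threeE.
have sv i : smooth_mx A U (fun q => cl_two gam (fun j k => (w i j k q)%:C)).
  exact: smooth_cl_two.
have sp i : smooth_mx A U (fun q => gam i *m cl_two gam (fun j k => (w i j k q)%:C)).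
  by apply: (smooth_mxM hM oU) => //; exact: smooth_mx_cst.
rewrite (dmatrixZ hM oU Up vp); last exact: (smooth_mx_sum hM oU).
rewrite (dmatrix_sum hM oU Up vp sp); congr (_ *: _); apply: eq_bigr => i _.
rewrite (dmatrixM hM oU Up vp) //; last exact: smooth_mx_cst.
by rewrite (dmatrix_cst vp) mul0mx add0r (dmatrix_cl_two Up vp).
Qed.

Definition spin_conn k q : 'M[R[i]]_(spin_dim n) :=
  cl_spin gam (fun i j => (om k i j q)%:C).

(** The derivative nabla_(e_k) of a spinor, or of several spinors at once as the
    columns of chi. *)
Definition spin_cov a k (chi : M -> 'M[R[i]]_(spin_dim n, a)) q :
    'M[R[i]]_(spin_dim n, a) :=
  dmatrix (e k q) chi + spin_conn k q *m chi q.

(** Clifford actions of T(e_k, -, -) and of T, named after the torsion of nabla^s,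
    which is 4 s T. *)
Definition torsion_two k q := cl_two gam (fun i j => (tc k i j q)%:C).
Definition torsion_three q := cl_three gam (fun i j k => (tc i j k q)%:C).

Let som i j k : smooth_on A U (om i j k).
Proof. exact: (omega_smooth hg hnabla he). Qed.

Lemma smooth_spin_conn k : smooth_mx A U (spin_conn k).
Proof.
rewrite /spin_conn; under eq_fun do rewrite cl_spinE.
by apply: (smooth_mxZ hM oU); exact: smooth_cl_two.
Qed.

Lemma smooth_torsion_two k : smooth_mx A U (torsion_two k).
Proof. by apply: smooth_cl_two => i j; exact: (torsion_comp_smooth he hT). Qed.

Lemma smooth_torsion_three : smooth_mx A U torsion_three.
Proof. by apply: smooth_cl_three => i j k; exact: (torsion_comp_smooth he hT). Qed.

Lemma smooth_dframe a k (chi : M -> 'M[R[i]]_(spin_dim n, a)) :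
  smooth_mx A U chi -> smooth_mx A U (fun q => dmatrix (e k q) chi).
Proof.
move=> sc i j; have [sR sI] := sc i j; have [_ se] := frame_smooth he k.
by split; under eq_fun do rewrite dmatrixE /=; apply: se.
Qed.

Lemma smooth_spin_cov a k (chi : M -> 'M[R[i]]_(spin_dim n, a)) :
  smooth_mx A U chi -> smooth_mx A U (spin_cov k chi).
Proof.
move=> sc; apply: (smooth_mxD hM oU); first exact: smooth_dframe.
by apply: (smooth_mxM hM oU) => //; exact: smooth_spin_conn.
Qed.

Section AtPoint.
Variable p : M.
Hypothesis Up : U p.

Local Notation w k i j := ((om k i j p)%:C).
Local Notation t i j k := ((tc i j k p)%:C).
Local Notation nt i j k l := ((nT i j k l p)%:C).

Lemma complex_omega_antisym k : antisym (fun i j => w k i j).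
Proof. by move=> i j; rewrite (omega_antisym hg hnabla he) // rmorphN. Qed.

Lemma complex_torsion_alternating : alternating3 (fun i j k => t i j k).
Proof.
split=> [i j k|i j k].
  by rewrite (torsion_comp_antisym12 he hT) // rmorphN.
by rewrite (torsion_comp_antisym23 he hT) // rmorphN.
Qed.

Lemma complex_nablaT_alternating i : alternating3 (fun j k l => nt i j k l).
Proof.
split=> [j k l|j k l].
  by rewrite (nablaT_antisym12 nabla he hT) // rmorphN.
by rewrite (nablaT_antisym23 nabla he hT) // rmorphN.
Qed.

Lemma spin_covD a k (x y : M -> 'M[R[i]]_(spin_dim n, a)) :
  smooth_mx A U x -> smooth_mx A U y ->
  spin_cov k (fun q => x q + y q) p = spin_cov k x p + spin_cov k y p.
Proof.
move=> sx sy; rewrite /spin_cov (dmatrixD oU Up (tane k Up)) // mulmxDr.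
by rewrite addrACA.
Qed.

Lemma spin_covZ a k z (x : M -> 'M[R[i]]_(spin_dim n, a)) : smooth_mx A U x ->
  spin_cov k (fun q => z *: x q) p = z *: spin_cov k x p.
Proof.
move=> sx; rewrite /spin_cov (dmatrixZ hM oU Up (tane k Up)) //.
by rewrite scalerDr -scalemxAr.
Qed.

Lemma spin_cov_sum a k (J : finType) (x : J -> M -> 'M[R[i]]_(spin_dim n, a)) :
  (forall j, smooth_mx A U (x j)) ->
  spin_cov k (fun q => \sum_j x j q) p = \sum_j spin_cov k (x j) p.
Proof.
move=> sx; rewrite /spin_cov (dmatrix_sum hM oU Up (tane k Up)) // mulmx_sumr.
by rewrite -big_split.
Qed.

(** The Leibniz rule, where the covariant derivative of an endomorphism F of the
    spinors is its derivative plus the commutator with the connection matrix. *)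
Lemma spin_covM a k (F : M -> 'M[R[i]]_(spin_dim n)) (x : M -> 'M[R[i]]_(spin_dim n, a)) :
  smooth_mx A U F -> smooth_mx A U x ->
  spin_cov k (fun q => F q *m x q) p = F p *m spin_cov k x p
   + (dmatrix (e k p) F + (spin_conn k p *m F p - F p *m spin_conn k p)) *m x p.
Proof.
move=> sF sx; rewrite /spin_cov (dmatrixM hM oU Up (tane k Up)) //.
rewrite mulmxDr !mulmxDl mulNmx !mulmxA; mx_ring.
Qed.

Lemma spin_cov_eq a k (x y : M -> 'M[R[i]]_(spin_dim n, a)) :
  (forall q, U q -> x q = y q) -> spin_cov k x p = spin_cov k y p.
Proof.
by move=> xy; rewrite /spin_cov xy // (dmatrix_eq oU Up (tane k Up) xy).
Qed.

Lemma spin_cov_gam a k l (x : M -> 'M[R[i]]_(spin_dim n, a)) : smooth_mx A U x ->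
  spin_cov k (fun q => gam l *m x q) p
  = gam l *m spin_cov k x p + cl_vec gam (fun m => w k l m) *m x p.
Proof.
move=> sx; rewrite (spin_covM k (smooth_mx_cst _ _ (gam l)) sx).
rewrite (dmatrix_cst (tane k Up)) add0r; congr (_ + _ *m _).
exact: (cl_spin_gam hgam l (complex_omega_antisym k)).
Qed.

Lemma spin_cov_torsion_three a k (x : M -> 'M[R[i]]_(spin_dim n, a)) : smooth_mx A U x ->
  spin_cov k (fun q => torsion_three q *m x q) p = torsion_three p *m spin_cov k x p
  + cl_three gam (fun i j l => nt k i j l) *m x p.
Proof.
move=> sx; rewrite (spin_covM k smooth_torsion_three sx).
congr (_ + _ *m _).
rewrite (dmatrix_cl_three Up (tane k Up)); last by move=> ? ? ?; exact: (torsion_comp_smooth he hT).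
rewrite (cl_spin_three hgam _ (complex_omega_antisym k)) -[LHS]cl_threeD; apply: eq_cl_three => i j l.
rewrite /nablaT rmorphB rmorph_sum -sumrN; congr (_ + _); apply: eq_bigr => m _ /=.
rewrite !rmorphD !rmorphM (complex_omega_antisym k m i) (complex_omega_antisym k m j) (complex_omega_antisym k m l); ring.
Qed.

(** The contraction of nabla_k T with e_l differs from the derivative of the
    contraction by the contraction of T with nabla_k e_l. *)
Lemma spin_cov_torsion_two a k l (x : M -> 'M[R[i]]_(spin_dim n, a)) : smooth_mx A U x ->
  spin_cov k (fun q => torsion_two l q *m x q) p = torsion_two l p *m spin_cov k x p
  + (cl_two gam (fun i j => nt k l i j) + \sum_m w k l m *: torsion_two m p) *m x p.
Proof.
move=> sx; rewrite (spin_covM k (@smooth_torsion_two l) sx).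
congr (_ + _ *m _).
rewrite (dmatrix_cl_two Up (tane k Up)); last by move=> ? ?; exact: (torsion_comp_smooth he hT).
rewrite (cl_spin_two hgam _ (complex_omega_antisym k)).
have -> : \sum_m w k l m *: torsion_two m p = cl_two gam (fun i j => \sum_m w k l m * t m i j).
  exact: (cl_two_sum gam (fun m => w k l m) (fun m i j => t m i j)).
rewrite -[LHS]cl_twoD -[RHS]cl_twoD; apply: eq_cl_two => i j.
rewrite /nablaT rmorphB rmorph_sum -addrA; congr (_ + _).
rewrite addrC -sumrB; apply: eq_bigr => m _ /=.
rewrite !rmorphD !rmorphM (complex_omega_antisym k m i) (complex_omega_antisym k m j); ring.
Qed.

Lemma dmatrix_spin_conn a b : dmatrix (e a p) (spin_conn b)
  = cl_spin gam (fun i j => (e a p (om b i j))%:C).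
Proof.
rewrite cl_spinE -(dmatrix_cl_two Up (tane a Up) (som b)).
rewrite -(dmatrixZ hM oU Up (tane a Up)); last exact: smooth_cl_two.
by congr dmatrix; apply/funext => q; rewrite -cl_spinE.
Qed.

(** As the spin lift is a Lie algebra morphism, this reduces to the structure
    equation for the Riemann tensor. *)
Lemma spin_curvature k l (x : M -> 'cV[R[i]]_(spin_dim n)) : smooth_mx A U x ->
  spin_cov k (spin_cov l x) p - spin_cov l (spin_cov k x) p
   - \sum_m (struct_coef g nabla e k l m p)%:C *: spin_cov m x p
  = cl_spin gam (fun i j => (riem A g nabla e k l i j p)%:C) *m x p.
Proof.
move=> sx.
have cov2 a b : spin_cov a (spin_cov b x) p =
   dmatrix (e a p) (fun q => dmatrix (e b q) x)
   + cl_spin gam (fun i j => (e a p (om b i j))%:C) *m x p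
   + spin_conn b p *m dmatrix (e a p) x + spin_conn a p *m dmatrix (e b p) x
   + spin_conn a p *m spin_conn b p *m x p.
  rewrite {1}/spin_cov [X in dmatrix (e a p) X](_ : _ =
    fun q => dmatrix (e b q) x + spin_conn b q *m x q) //.
  rewrite (dmatrixD oU Up (tane a Up)); [|exact: smooth_dframe|]; last first.
    by apply: (smooth_mxM hM oU) => //; exact: smooth_spin_conn.
  rewrite (dmatrixM hM oU Up (tane a Up)) //; last exact: smooth_spin_conn.
  rewrite dmatrix_spin_conn.
  exact: second_derivative_expand.
have d2 : dmatrix (e k p) (fun q => dmatrix (e l q) x)
   - dmatrix (e l p) (fun q => dmatrix (e k q) x)
   = \sum_m (struct_coef g nabla e k l m p)%:C *: dmatrix (e m p) x.
  apply/matrixP => i j; rewrite summxE mxD mxN.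
  have dd a b : dmatrix (e a p) (fun q => dmatrix (e b q) x) i j =
      (e a p (fun q => e b q (fun r => complex.Re (x r i j)))) +i*
      (e a p (fun q => e b q (fun r => complex.Im (x r i j)))).
    rewrite dmatrixE /dcomplex.
    by congr (_ +i* _); congr (e a p _); apply/funext => q; rewrite dmatrixE.
  have [sR sI] := sx i j.
  have fc := frame_derivative_comm hg hnabla he k l Up.
  rewrite !dd; transitivity
    ((\sum_m struct_coef g nabla e k l m p * e m p (fun r => complex.Re (x r i j))) +i*
     (\sum_m struct_coef g nabla e k l m p * e m p (fun r => complex.Im (x r i j)))).
    by rewrite -!fc //; exists U.
  elim: (index_enum _) => [|m r IH]; first by rewrite !big_nil.
  rewrite !big_cons -IH mxZ dmatrixE /dcomplex.
  by apply/eqP; rewrite eq_complex /= !mul0r subr0 addr0 !eqxx.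
have str : \sum_m (struct_coef g nabla e k l m p)%:C *: spin_cov m x p =
   \sum_m (struct_coef g nabla e k l m p)%:C *: dmatrix (e m p) x +
   cl_spin gam (fun i j =>
      \sum_m (struct_coef g nabla e k l m p)%:C * w m i j) *m x p.
  rewrite -(cl_spin_sum gam (fun m => (struct_coef g nabla e k l m p)%:C)
    (fun m i j => w m i j)) mulmx_suml -big_split.
  apply: eq_bigr => m _; rewrite /spin_cov /= scalerDr scalemxAl //.
transitivity ((cl_spin gam (fun i j => (e k p (om l i j))%:C)
    - cl_spin gam (fun i j => (e l p (om k i j))%:C)
    - cl_spin gam (fun i j => \sum_m (struct_coef g nabla e k l m p)%:C * w m i j)
   + (spin_conn k p *m spin_conn l p - spin_conn l p *m spin_conn k p)) *m x p).
  rewrite str !cov2 -d2; exact: second_derivative_comm.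
rewrite (cl_spin_spin hgam _ (complex_omega_antisym k)); congr (_ *m _).
rewrite cl_spin_comb; apply: eq_cl_spin => i j.
rewrite (riemE hM hg hnabla he) // !(rmorphB, rmorphD) /= !rmorph_sum /=.
have -> : \sum_m (w k m i * w l m j + w l i m * w k m j) =
   \sum_m (om k i m p * om l j m p)%:C - \sum_m (om l i m p * om k j m p)%:C.
  rewrite -sumrB; apply: eq_bigr => m _.
  rewrite (complex_omega_antisym k m i) (complex_omega_antisym l m j) (complex_omega_antisym k m j) !rmorphM /=; ring.
have -> : \sum_m (struct_coef g nabla e k l m p)%:C * w m i j =
   \sum_m (struct_coef g nabla e k l m p * om m i j p)%:C.
  by apply: eq_bigr => m _; rewrite rmorphM.
ring.
Qed.
End AtPoint.

End SpinConnection.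

(** * The two operators in a frame *)

Section CliffordForms.
Context {R : realType} {n : nat}.
Variable gam : 'I_n -> 'M[R[i]]_(spin_dim n).
Hypothesis hgam : clifford_rep gam.

Lemma cliff2E (w : 'I_n -> 'I_n -> R) : (forall i j, w i j = - w j i) ->
  cliff2 gam w = cl_two gam (fun i j => (w i j)%:C).
Proof.
move=> wA; rewrite -(sum_ltn_cl_two hgam) // => i j.
by rewrite wA rmorphN.
Qed.

Lemma cliff4E (f : 'I_n -> 'I_n -> 'I_n -> 'I_n -> R) :
  (forall i j k l, f i j k l = - f j i k l) ->
  (forall i j k l, f i j k l = - f i k j l) ->
  (forall i j k l, f i j k l = - f i j l k) ->
  cliff4 gam f = cl_four gam (fun i j k l => (f i j k l)%:C).
Proof.
move=> f12 f23 f34; rewrite -(sum_ltn_cl_four hgam) // => i j k l.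
- by rewrite f12 rmorphN.
- by rewrite f23 rmorphN.
- by rewrite f34 rmorphN.
Qed.

End CliffordForms.

Lemma subrB_interchange (V : zmodType) (x y u v : V) :
  x - u - (y - v) = x - y - (u - v).
Proof. by rewrite opprD addrACA -opprD. Qed.

Section LocalExpressions.
Context {R : realType} {n : nat} {M : topologicalType}.
Variable (A : set (chart R n M)).
Hypothesis hM : smooth_manifold A.
Variables (g : M -> tvec R M -> tvec R M -> R).
Hypothesis hg : riemannian_metric A g.
Variables (nabla : M -> tvec R M -> vfield R M -> tvec R M).
Hypothesis hnabla : levi_civita A g nabla.
Variables (I : Type) (e : I -> 'I_n -> vfield R M) (a : I) (U : set M).
Hypothesis he : orthonormal_frame A g U (e a).
Variable T : M -> tvec R M -> tvec R M -> tvec R M -> R.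
Hypothesis hT : three_form A T.
Variable gam : 'I_n -> 'M[R[i]]_(spin_dim n).
Hypothesis hgam : clifford_rep gam.

Local Notation om := (omega g nabla (e a)).
Local Notation tc := (torsion_comp (e a) T).
Local Notation nT := (nablaT g nabla (e a) T).
Local Notation cov := (spin_cov g nabla (e a) gam).
Local Notation tau := (torsion_two (e a) T gam).
Local Notation tri := (torsion_three (e a) T gam).

Let oU : open U. Proof. exact: frame_open he. Qed.
Let tane p i : U p -> tangent A p (e a i p).
Proof. by move=> Up; exact: (frame_smooth he i).1. Qed.

Lemma dspinorE v (phi : M -> 'cV[R[i]]_(spin_dim n)) : dspinor v phi = dmatrix v phi.
Proof. by apply/matrixP => i j; rewrite dmatrixE !mxE ord1. Qed.

(** The covariant derivative is linear in the direction, which is needed for the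
    directions nabla_(e_k) e_k in the Laplacian. *)
Lemma nabla_s_expand s X (psi : I -> M -> 'cV[R[i]]_(spin_dim n)) p :
  U p -> tangent A p (X p) ->
  nabla_s gam g nabla T e s X psi a p =
  \sum_m (g p (X p) (e a m p))%:C *:
     (cov m (psi a) p + s%:C *: (tau m p *m psi a p)).
Proof.
move=> Up; rewrite /nabla_s /spin_nabla; set v := X p => tv; rewrite dspinorE.
have wE i j : g p (nabla p v (e a i)) (e a j p) =
    \sum_m g p v (e a m p) * om m i j p.
  rewrite (frame_expand hg he (L := fun u => g p (nabla p u (e a i)) (e a j p)) Up) //.
  by apply: (tlinear_nabla_metric hg hnabla he) => //; exact: tane.
have tE i j : T p v (e a i p) (e a j p) = \sum_m g p v (e a m p) * tc m i j p.
  rewrite (frame_expand hg he (L := fun u => T p u (e a i p) (e a j p)) Up) //.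
  by move=> b u u' tu tu'; apply: (form_linear hT) => //; exact: tane.
have -> : (2^-1)%:C *: (cliff2 gam (fun i j => g p (nabla p v (e a i)) (e a j p))
    *m psi a p) = (\sum_m (g p v (e a m p))%:C *: spin_conn g nabla (e a) gam m p)
      *m psi a p.
  rewrite (cliff2E hgam); last first.
    move=> i j; rewrite !wE -sumrN; apply: eq_bigr => m _.
    by rewrite (omega_antisym hg hnabla he) // mulrN.
  rewrite fmorphV rmorph_nat scalemxAl -cl_spinE; congr (_ *m _).
  rewrite (cl_spin_sum gam (fun m => (g p v (e a m p))%:C) (fun m i j => (om m i j p)%:C)).
  apply: eq_cl_spin => i j; rewrite wE rmorph_sum.
  by apply: eq_bigr => m _; rewrite rmorphM.
have -> : cliff2 gam (fun i j => T p v (e a i p) (e a j p)) =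
  \sum_m (g p v (e a m p))%:C *: tau m p.
  rewrite (cliff2E hgam); last first.
    move=> i j; rewrite !tE -sumrN; apply: eq_bigr => m _.
    by rewrite (torsion_comp_antisym23 he hT) // mulrN.
  rewrite (cl_two_sum gam (fun m => (g p v (e a m p))%:C) (fun m i j => (tc m i j p)%:C)).
  apply: eq_cl_two => i j; rewrite tE rmorph_sum.
  by apply: eq_bigr => m _; rewrite rmorphM.
have -> : dmatrix v (psi a) = \sum_m (g p v (e a m p))%:C *: dmatrix (e a m p) (psi a).
  have ve f : v f = \sum_m g p v (e a m p) * e a m p f.
    by rewrite (frame_expand hg he (L := fun u => u f) Up).
  apply/matrixP => i j; rewrite summxE dmatrixE /dcomplex !ve.
  elim: (index_enum _) => [|m r IH]; first by rewrite !big_nil.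
  rewrite !big_cons -IH mxZ dmatrixE /dcomplex.
  by apply/eqP; rewrite eq_complex /= !mul0r subr0 addr0 !eqxx.
exact: connection_sum.
Qed.

Lemma nabla_s_frame s k (psi : I -> M -> 'cV[R[i]]_(spin_dim n)) p : U p ->
  nabla_s gam g nabla T e s (e a k) psi a p =
  cov k (psi a) p + s%:C *: (tau k p *m psi a p).
Proof.
move=> Up; rewrite nabla_s_expand //; last exact: tane.
rewrite (bigD1 k) //= (frame_orthonormal he) // eqxx scale1r big1 ?addr0 // => m mk.
by rewrite (frame_orthonormal he) // eq_sym (negPf mk) scale0r.
Qed.

(** This is where the parameter s/3 enters: sum_k e_k tau_k is 3 T. *)
Lemma dirac_op_frame s (psi : I -> M -> 'cV[R[i]]_(spin_dim n)) p : U p ->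
  dirac_op gam g nabla T e (s / 3) psi a p =
  \sum_k gam k *m cov k (psi a) p + s%:C *: (tri p *m psi a p).
Proof.
move=> Up; rewrite /dirac_op.
under eq_bigr do rewrite nabla_s_frame // rmorphM fmorphV rmorph_nat.
exact: (dirac_three_form gam (fun i j k => (tc i j k p)%:C) (fun k => cov k (psi a) p)).
Qed.

Section AtPoint.
Variables (s : R) (psi : I -> M -> 'cV[R[i]]_(spin_dim n)) (p : M).
Hypothesis Up : U p.
Hypothesis sp : smooth_mx A U (psi a).

Let scov k : smooth_mx A U (cov k (psi a)).
Proof. exact: (smooth_spin_cov hM hg hnabla he). Qed.

Let sgcov l : smooth_mx A U (fun q => gam l *m cov l (psi a) q).
Proof. apply: (smooth_mxM hM oU); [exact: smooth_mx_cst|exact: scov]. Qed.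

Let stri : smooth_mx A U (fun q => tri q *m psi a q).
Proof. by apply: (smooth_mxM hM oU) => //; exact: (smooth_torsion_three hM he hT). Qed.

Let stau k : smooth_mx A U (fun q => tau k q *m psi a q).
Proof. by apply: (smooth_mxM hM oU) => //; exact: (smooth_torsion_two hM he hT). Qed.

Lemma spin_cov_dirac k : cov k (dirac_op gam g nabla T e (s / 3) psi a) p =
   \sum_l (gam l *m cov k (cov l (psi a)) p
     + cl_vec gam (fun m => (om k l m p)%:C) *m cov l (psi a) p)
   + s%:C *: (tri p *m cov k (psi a) p
     + cl_three gam (fun i j l => (nT k i j l p)%:C) *m psi a p).
Proof.
transitivity (cov k (fun q => \sum_l gam l *m cov l (psi a) q
    + s%:C *: (tri q *m psi a q)) p).
  by apply: (spin_cov_eq nabla he gam Up k) => q Uq; rewrite dirac_op_frame.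
have s1 : smooth_mx A U (fun q => \sum_l gam l *m cov l (psi a) q).
  exact: (smooth_mx_sum hM oU).
have s2 : smooth_mx A U (fun q => s%:C *: (tri q *m psi a q)).
  exact: (smooth_mxZ hM oU).
apply: (etrans (spin_covD nabla he gam Up k s1 s2)); apply: (f_equal2 +%R).
  apply: (etrans (spin_cov_sum hM nabla he gam Up k sgcov)).
  apply: eq_bigr => l _.
  exact: (spin_cov_gam hM hg hnabla he hgam Up k l (scov l)).
apply: (etrans (spin_covZ hM nabla he gam Up k s%:C stri)).
exact: (congr1 (fun y => s%:C *: y) (spin_cov_torsion_three hM hg hnabla he hT hgam Up k sp)).
Qed.

Lemma spin_covD_torsion chi k : smooth_mx A U chi ->
  cov k (fun q => chi q + s%:C *: (tau k q *m psi a q)) p =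
  cov k chi p + s%:C *: (tau k p *m cov k (psi a) p
   + (cl_two gam (fun i j => (nT k k i j p)%:C)
      + \sum_m (om k k m p)%:C *: tau m p) *m psi a p).
Proof.
move=> sc; have s2 := smooth_mxZ hM oU s%:C (stau k).
apply: (etrans (spin_covD nabla he gam Up k sc s2)).
apply: (congr1 (fun y => cov k chi p + y)).
apply: (etrans (spin_covZ hM nabla he gam Up k s%:C (stau k))).
exact: (congr1 (fun y => s%:C *: y) (spin_cov_torsion_two hM hg hnabla he hT hgam Up k k sp)).
Qed.

Lemma spin_cov_nabla_s k : cov k (nabla_s gam g nabla T e s (e a k) psi a) p =
  cov k (cov k (psi a)) p + s%:C *: (tau k p *m cov k (psi a) p
   + (cl_two gam (fun i j => (nT k k i j p)%:C)
      + \sum_m (om k k m p)%:C *: tau m p) *m psi a p).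
Proof.
apply: etrans (@spin_covD_torsion (cov k (psi a)) k (scov k)).
by apply: (spin_cov_eq nabla he gam Up k) => q Uq; rewrite nabla_s_frame.
Qed.

Lemma dT_action_frame : dT_action A gam T e psi a p =
  cl_four gam (alternation (fun i j k l => (nT i j k l p)%:C)) *m psi a p.
Proof.
rewrite /dT_action; congr (_ *m _).
pose f i j k l := nT i j k l p - nT j i k l p + nT k i j l p - nT l i j k p.
rewrite (_ : (fun i j k l => ext_deriv _ _ _ _ _ _ _) = f); last first.
  apply/funext => i; apply/funext => j; apply/funext => k; apply/funext => l.
  exact: (ext_deriv_frame hg hnabla he hT).
have a12 i j k l := nablaT_antisym12 nabla he hT i j k l Up.
have a23 i j k l := nablaT_antisym23 nabla he hT i j k l Up.
rewrite (cliff4E hgam) /f.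
- congr cl_four; apply/funext => i; apply/funext => j; apply/funext => k.
  by apply/funext => l; rewrite /alternation !(rmorphB, rmorphD).
- by move=> i j k l; rewrite (a12 k j i l) (a12 l j i k); ring.
- by move=> i j k l; rewrite (a12 i k j l) (a23 l i k j); ring.
- by move=> i j k l; rewrite (a23 i j l k) (a23 j i l k); ring.
Qed.

Lemma dirac_square_frame :
  dirac_op gam g nabla T e (s / 3) (dirac_op gam g nabla T e (s / 3) psi) a p
  = spinor_laplacian gam g nabla T e s psi a p
    + s%:C *: dT_action A gam T e psi a p
    + (4^-1 * scalar_curvature A g nabla (e a) p)%:C *: psi a p
    - (2 * s ^+ 2 * T0_squared g T (e a) p)%:C *: psi a p.
Proof.
have lap : spinor_laplacian gam g nabla T e s psi a p =
  - \sum_k (cov k (cov k (psi a)) p + s%:C *: (tau k p *m cov k (psi a) p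
         + (cl_two gam (fun i j => (nT k k i j p)%:C)
            + \sum_m (om k k m p)%:C *: tau m p) *m psi a p)
      + s%:C *: (tau k p *m (cov k (psi a) p + s%:C *: (tau k p *m psi a p)))
      - \sum_m (om k k m p)%:C *: (cov m (psi a) p + s%:C *: (tau m p *m psi a p))).
  rewrite /spinor_laplacian; congr (- _); apply: eq_bigr => k _.
  rewrite nabla_s_frame // spin_cov_nabla_s nabla_s_frame // nabla_s_expand //.
  by apply: (lc_smooth hnabla oU (frame_smooth he k) (frame_smooth he k)).1.
have scal : (4^-1 * scalar_curvature A g nabla (e a) p)%:C =
    4^-1 * \sum_i \sum_j (riem A g nabla (e a) i j j i p)%:C.
  rewrite rmorphM fmorphV rmorph_nat /scalar_curvature rmorph_sum; congr (_ * _).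
  by apply: eq_bigr => i _; rewrite rmorph_sum.
have t0 : (2 * s ^+ 2 * T0_squared g T (e a) p)%:C =
    2 * s%:C ^+ 2 * (6^-1 * \sum_i \sum_j \sum_k (tc i j k p)%:C ^+ 2).
  rewrite (T0_squared_frame hg he) // rmorphM; congr (_ * _).
    by rewrite rmorphM rmorphXn rmorph_nat.
  rewrite rmorphM fmorphV rmorph_nat; congr (_ * _).
  rewrite rmorph_sum; apply: eq_bigr => i _; rewrite rmorph_sum; apply: eq_bigr => j _.
  by rewrite rmorph_sum; apply: eq_bigr => k _; rewrite rmorphXn.
have curv k l : (cov k (cov l (psi a)) p - \sum_m (om k l m p)%:C *: cov m (psi a) p)
   - (cov l (cov k (psi a)) p - \sum_m (om l k m p)%:C *: cov m (psi a) p)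
   = cl_spin gam (fun i j => (riem A g nabla (e a) k l i j p)%:C) *m psi a p.
  rewrite -(spin_curvature hM hg hnabla he hgam Up k l sp).
  have -> : \sum_m (struct_coef g nabla (e a) k l m p)%:C *: cov m (psi a) p =
     \sum_m (om k l m p)%:C *: cov m (psi a) p - \sum_m (om l k m p)%:C *: cov m (psi a) p.
    by rewrite -sumrB; apply: eq_bigr => m _; rewrite -scalerBl -rmorphB.
  exact: subrB_interchange.
rewrite dirac_op_frame // dirac_op_frame // lap scal t0 dT_action_frame.
under eq_bigr do rewrite spin_cov_dirac.
apply: (dirac_square_at hgam _ _ _ _ curv).
- by move=> k; exact: (complex_omega_antisym hg hnabla he Up k).
- by move=> i j k l; rewrite (riem_antisym12 hM hg hnabla he) // rmorphN.
- by move=> i j k l; rewrite (riem_antisym34 hM hg hnabla he) // rmorphN.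
- move=> i j k l; rewrite -!rmorphD /=.
  by rewrite (riem_bianchi hM hg hnabla he).
- exact: (complex_torsion_alternating he hT Up).
- by move=> k; exact: (complex_nablaT_alternating nabla he hT Up k).
Qed.

End AtPoint.

End LocalExpressions.


Theorem theorem6p2 (R : realType) (n : nat) (M : topologicalType)
    (A : set (chart R n M)) (hM : smooth_manifold A)
    (g : M -> tvec R M -> tvec R M -> R) (hg : riemannian_metric A g)
    (nabla : M -> tvec R M -> vfield R M -> tvec R M)
    (hnabla : levi_civita A g nabla)
    (gam : 'I_n -> 'M[R[i]]_(spin_dim n)) (hgam : clifford_rep gam)
    (I : Type) (U : I -> set M) (e : I -> 'I_n -> vfield R M)
    (h : I -> I -> M -> 'M[R[i]]_(spin_dim n))
    (hspin : spin_structure A gam g U e h)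
    (T : M -> tvec R M -> tvec R M -> tvec R M -> R) (hT : three_form A T)
    (s : R) (psi : I -> M -> 'cV[R[i]]_(spin_dim n))
    (hpsi : spinor_field A U h psi)
    (a : I) (p : M) (hp : U a p) :
  dirac_op gam g nabla T e (s / 3) (dirac_op gam g nabla T e (s / 3) psi) a p
  = spinor_laplacian gam g nabla T e s psi a p
    + s%:C *: dT_action A gam T e psi a p
    + (4^-1 * scalar_curvature A g nabla (e a) p)%:C *: psi a p
    - (2 * s ^+ 2 * T0_squared g T (e a) p)%:C *: psi a p.

Proof.
have he := spin_frame hspin a.
apply: (dirac_square_frame hM hg hnabla he hT hgam s hp).
by move=> k j; rewrite ord1; exact: spinor_smooth hpsi a k.
Qed.
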